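(* Let $(X,d)$ be a complete separable metric space with a fixed dense sequence $(x_i)_{i\in\mathbb{N}}$, let $T\colon X\to X$ be continuous and let $u\colon X\to\mathbb{R}$ be uniformly continuous. Let $Z\subset X$ be such that $\underline{u}(x)>0$ for all $x\in Z$, where $\underline{u}(x)=\liminf_{n\to\infty}\frac{1}{n}S_nu(x)$. Then $$\dim_{\mathrm{BS}}(Z,T,u)=\min_{A\subset\mathbb{N}}\ \sup_{x\in Z}\dim^A_{\mathrm{BS}}(x,T,u),\qquad \mathrm{Dim}_{\mathrm{BS}}(Z,T,u)=\min_{A\subset\mathbb{N}}\ \sup_{x\in Z}\mathrm{Dim}^A_{\mathrm{BS}}(x,T,u),$$ where the minima (which are attained) are over all oracles $A\subset\mathbb{N}$.
   Context: Dynamics: $S_nu=\sum_{k=0}^{n-1}u\circ T^k$; the Bowen ball is $B_n(x,T,\varepsilon)=\{y\in X: d(T^ix,T^iy)<\varepsilon \text{ for } 0\le i<n\}$; $u(x,n,\varepsilon)=\sup_{y\in B_n(x,T,\varepsilon)}S_nu(y)$. Complexity: fix a universal prefix-free oracle machine $U$. For an oracle $A\subset\mathbb{N}$ and a finite binary string $\sigma$, $K^A(\sigma)=\min\{|\tau|: U^A(\tau)=\sigma\}$; natural numbers are identified with strings through a fixed computable coding. Pointwise BS dimensions: for $x$ with $\underline{u}(x)>0$ and $\varepsilon>0$, $$\dim^A_{\mathrm{BS}}(x,T,u,\varepsilon)=\liminf_{n\to\infty}\min_{x_i\in B_n(x,T,\varepsilon)}\frac{K^A(i)}{S_nu(x_i)},\qquad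 \dim^A_{\mathrm{BS}}(x,T,u)=\lim_{\varepsilon\to0}\dim^A_{\mathrm{BS}}(x,T,u,\varepsilon),$$ and $\mathrm{Dim}^A_{\mathrm{BS}}(x,T,u,\varepsilon)$, $\mathrm{Dim}^A_{\mathrm{BS}}(x,T,u)$ are defined in the same way with $\limsup_{n\to\infty}$. (For $\varepsilon$ small and $n$ large the denominators are positive; $\dim^A_{\mathrm{BS}}(x,T,u)$ and $\mathrm{Dim}^A_{\mathrm{BS}}(x,T,u)$ lie in $[0,\infty]$.) Lower BS dimension: let $\mathcal{P}(Z,N,\varepsilon)$ be the collection of countable families $\{(y_j,n_j)\}\subset X\times\{N,N+1,\dots\}$ with $Z\subset\bigcup_jB_{n_j}(y_j,T,\varepsilon)$. For $s\ge0$ put $m_{BS}(Z,s,u,N,\varepsilon)=\inf_{\mathcal{P}(Z,N,\varepsilon)}\sum_j2^{-s\,u(y_j,n_j,\varepsilon)}$ and $m_{BS}(Z,s,u,\varepsilon)=\lim_{N\to\infty}m_{BS}(Z,s,u,N,\varepsilon)$. Then $\dim_{\mathrm{BS}}(Z,T,u,\varepsilon)=\inf\{s\ge0: m_{BS}(Z,s,u,\varepsilon)=0\}$ (with $\inf\emptyset=\infty$) and $\dim_{\mathrm{BS}}(Z,T,u)=\lim_{\varepsilon\to0}\dim_{\mathrm{BS}}(Z,T,u,\varepsilon)$. Upper BS dimension: for $s\ge0$, $M(Z,T,u,s,n,\varepsilon)=\inf\{\sum_{x\in\Gamma}2^{-s\,u(x,n,\varepsilon)}:\Gamma\subset X\text{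 countable}, Z\subset\bigcup_{x\in\Gamma}B_n(x,T,\varepsilon)\}$; $\dim_{\mathrm{BSC}}(Z,T,u,\varepsilon)=\inf\{s\ge0:\limsup_{n\to\infty}M(Z,T,u,s,n,\varepsilon)<\infty\}$ (with $\inf\emptyset=\infty$); $\mathrm{Dim}_{\mathrm{BS}}(Z,T,u,\varepsilon)=\inf\{\sup_i\dim_{\mathrm{BSC}}(Z_i,T,u,\varepsilon): Z\subset\bigcup_{i\in\mathbb{N}}Z_i\}$ (infimum over countable covers); $\mathrm{Dim}_{\mathrm{BS}}(Z,T,u)=\lim_{\varepsilon\to0}\mathrm{Dim}_{\mathrm{BS}}(Z,T,u,\varepsilon)$. *)

(* Defs.v *)
From Stdlib Require Cantor.
From HB Require Import structures.
From mathcomp Require Import all_boot all_order all_algebra.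
From mathcomp Require Import all_classical all_reals all_analysis.
Set Implicit Arguments.
Unset Strict Implicit.
Unset Printing Implicit Defensive.
Import Order.TTheory GRing.Theory Num.Theory.
Import numFieldNormedType.Exports.
Local Open Scope classical_set_scope.
Local Open Scope ring_scope.

(* Oracle machines are programs for the unary functions partial recursive in
   an oracle; several arguments are passed through Cantor's pairing bijection
   Cantor.to_nat : nat * nat -> nat, with inverse Cantor.of_nat. *)
Inductive oracle_code : Type :=
| OZero
| OSucc
| OFst
| OSnd
| OQuery
| OPair of oracle_code & oracle_code
| OComp of oracle_code & oracle_code
| OPrec of oracle_code & oracle_code
| OMin of oracle_code.

(* [oeval A c a r]: with oracle [A], program [c] halts on input [a] with
   result [r].  [OPrec f g] is primitive recursion: <a, 0> |-> f a and
   <a, k+1> |-> g <a, <k, value at <a, k>>>.  [OMin f] is unbounded search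
   for the least k with f <a, k> = 0, all earlier values being defined. *)
Fixpoint oeval (A : set nat) (c : oracle_code) : nat -> nat -> Prop :=
  match c with
  | OZero => fun a r => r = 0%N
  | OSucc => fun a r => r = a.+1
  | OFst => fun a r => r = (Cantor.of_nat a).1
  | OSnd => fun a r => r = (Cantor.of_nat a).2
  | OQuery => fun a r => r = nat_of_bool (a \in A)
  | OPair f g => fun a r => exists p q,
      [/\ oeval A f a p, oeval A g a q & r = Cantor.to_nat (p, q)]
  | OComp f g => fun a r => exists2 b, oeval A g a b & oeval A f b r
  | OPrec f g => fun a =>
      let b := (Cantor.of_nat a).1 in
      (fix rec (k : nat) : nat -> Prop :=
         if k is k'.+1 then
           fun r => exists2 v, rec k' v
             & oeval A g (Cantor.to_nat (b, Cantor.to_nat (k', v))) r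
         else oeval A f b) (Cantor.of_nat a).2
  | OMin f => fun a r =>
      oeval A f (Cantor.to_nat (a, r)) 0%N /\
      forall k, (k < r)%N ->
        exists v, oeval A f (Cantor.to_nat (a, k)) v.+1
  end.

(* Bijective base-2 coding of binary strings, least significant digit first. *)
Fixpoint nat_of_str (s : seq bool) : nat :=
  if s is b :: s' then (b + (nat_of_str s').*2).+1 else 0%N.

Fixpoint str_succ (s : seq bool) : seq bool :=
  match s with
  | [::] => [:: false]
  | false :: s' => true :: s'
  | true :: s' => false :: str_succ s'
  end.

Definition str_of_nat (n : nat) : seq bool := iter n str_succ [::].

Lemma nat_of_str_succ s : nat_of_str (str_succ s) = (nat_of_str s).+1.
Proof. by elim: s => [|[] s IHs] //=; rewrite IHs doubleS. Qed.

Lemma str_of_natK : cancel str_of_nat nat_of_str.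
Proof. by elim=> [//|n IHn]; rewrite /= nat_of_str_succ IHn. Qed.

Lemma nat_of_str_inj : injective nat_of_str.
Proof.
elim=> [|b s IHs] [|b' s'] //= [e].
have eb : b = b'.
  by move/(congr1 odd): e; rewrite !oddD !odd_double !addbF; case: b b' => [] [].
by move: e; rewrite eb => /addnI /double_inj /IHs ->.
Qed.

Lemma nat_of_strK : cancel nat_of_str str_of_nat.
Proof. by move=> s; apply: nat_of_str_inj; rewrite str_of_natK. Qed.

(* [orun M A t s]: M^A(t) = s. *)
Definition orun (M : oracle_code) (A : set nat) (t s : seq bool) : Prop :=
  oeval A M (nat_of_str t) (nat_of_str s).

Definition ohalts (M : oracle_code) (A : set nat) (t : seq bool) : Prop :=
  exists r, oeval A M (nat_of_str t) r.

Definition prefix_free_machine (M : oracle_code) : Prop :=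
  forall (A : set nat) (t t' : seq bool),
    ohalts M A t -> ohalts M A t' -> prefix t t' -> t = t'.

(* [U] simulates every prefix-free oracle machine after a fixed header,
   uniformly in the oracle. *)
Definition universal_prefix_free (U : oracle_code) : Prop :=
  prefix_free_machine U /\
  forall M, prefix_free_machine M ->
    exists h : seq bool, forall (A : set nat) (t s : seq bool),
      orun U A (h ++ t) s <-> orun M A t s.

Definition describable (U : oracle_code) (A : set nat) (s : seq bool) (n : nat) :=
  `[< exists2 t : seq bool, size t = n & orun U A t s >].

(* The default value 0 is never used when [U] is universal: every string then
   has a description. *)
Definition complexity (U : oracle_code) (A : set nat) (s : seq bool) : nat :=
  match pselect (exists n, describable U A s n) with
  | left h => ex_minn h
  | right _ => 0%N
  end.

Definition complexity_nat (U : oracle_code) (A : set nat) (i : nat) : nat :=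
  complexity U A (str_of_nat i).

Section Dimensions.
Context {R : realType} {X : metricType R}.
Implicit Types (T : X -> X) (u : X -> R) (x y : X) (n N : nat) (e s : R)
  (Z : set X).

Definition complete_space : Prop :=
  forall F : set_system X, ProperFilter F -> cauchy F -> exists l : X, F --> l.

Definition birkhoff_sum T u n x : R := \sum_(k < n) u (iter k T x).

Definition lower_average T u x : \bar R :=
  limn_einf (fun n => (birkhoff_sum T u n x / n%:R)%:E).

Definition bowen_ball T n x e : set X :=
  [set y | forall i, (i < n)%N -> mdist (iter i T x) (iter i T y) < e].

(* Extended real valued: it may be +oo when [e] is large. *)
Definition bowen_sup T u n x e : \bar R :=
  ereal_sup [set (birkhoff_sum T u n y)%:E | y in bowen_ball T n x e].

Definition pow2e (v : \bar R) : \bar R :=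
  match v with
  | r%:E => (2 `^ r)%:E
  | +oo%E => +oo%E
  | -oo%E => 0%E
  end.

(* For [e] small and [n] large the denominators are positive and the infimum is
   a minimum; the finitely many other [n] do not affect the limits. *)
Definition complexity_ratio (xs : nat -> X) (U : oracle_code) (A : set nat)
    T u x e n : \bar R :=
  ereal_inf [set ((complexity_nat U A i)%:R / birkhoff_sum T u n (xs i))%:E
            | i in [set i | bowen_ball T n x e (xs i)]].

Definition point_dim_at xs U A T u x e : \bar R :=
  limn_einf (complexity_ratio xs U A T u x e).

Definition point_Dim_at xs U A T u x e : \bar R :=
  limn_esup (complexity_ratio xs U A T u x e).

Definition point_dim xs U A T u x : \bar R :=
  lim (point_dim_at xs U A T u x e @[e --> 0^'+]).

Definition point_Dim xs U A T u x : \bar R :=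
  lim (point_Dim_at xs U A T u x e @[e --> 0^'+]).

Definition bowen_covers T Z N e : set (set (X * nat)) :=
  [set F | [/\ countable F, (forall p, F p -> (N <= p.2)%N)
    & Z `<=` \bigcup_(p in F) bowen_ball T p.2 p.1 e]].

Definition mBS_at T u Z s N e : \bar R :=
  ereal_inf [set (\esum_(p in F) pow2e (- s%:E * bowen_sup T u p.2 p.1 e))%E
            | F in bowen_covers T Z N e].

Definition mBS T u Z s e : \bar R := limn (fun N => mBS_at T u Z s N e).

Definition dimBS_at T u Z e : \bar R :=
  ereal_inf [set s%:E | s in [set s | 0 <= s /\ mBS T u Z s e = 0%E]].

Definition dimBS T u Z : \bar R := lim (dimBS_at T u Z e @[e --> 0^'+]).

Definition capBS_at T u Z s n e : \bar R :=
  ereal_inf [set (\esum_(x in G) pow2e (- s%:E * bowen_sup T u n x e))%E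
            | G in [set G : set X | countable G /\
                      Z `<=` \bigcup_(x in G) bowen_ball T n x e]].

Definition dimBSC_at T u Z e : \bar R :=
  ereal_inf [set s%:E | s in
    [set s | 0 <= s /\ (limn_esup (fun n => capBS_at T u Z s n e) < +oo)%E]].

Definition DimBS_at T u Z e : \bar R :=
  ereal_inf [set ereal_sup (range (fun i => dimBSC_at T u (Zs i) e))
            | Zs in [set Zs : nat -> set X | Z `<=` \bigcup_i Zs i]].

Definition DimBS T u Z : \bar R := lim (DimBS_at T u Z e @[e --> 0^'+]).

(* Supremum in [0, +oo]: the supremum over the empty set is 0, not -oo. *)
Definition nneg_sup Z (f : X -> \bar R) : \bar R :=
  ereal_sup (0%E |` [set f x | x in Z]).

End Dimensions.
Arguments complete_space {R} X.

Definition is_minimum {R : realType} (S : set (\bar R)) (m : \bar R) : Prop :=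
  S m /\ lbound S m.

(* Main.v *)
Require Import Defs.
From HB Require Import structures.
From mathcomp Require Import all_boot all_order all_algebra.
From mathcomp Require Import all_classical all_reals all_analysis.
From mathcomp Require Import ring lra zify.
Set Implicit Arguments.
Unset Strict Implicit.
Unset Printing Implicit Defensive.
Import Order.TTheory GRing.Theory Num.Theory.
Import numFieldNormedType.Exports.
Local Open Scope classical_set_scope.
Local Open Scope ring_scope.

(** A cheap Bowen cover and a short description of points are the same thing,
    once an oracle is available that knows the cover.

    Every oracle gives an upper bound of the set dimension.  By Kraft's
    inequality the weights 2^-K(i) of the dense points have sum at most 1
    ([complexity_kraft]).  If the dimension of every point of Z is below s, then
    every x in Z is, for infinitely many n (for all large n in the case of Dim),
    within the n-th Bowen ball of some x_i with K(i) <= s S_n u(x_i).  These x_i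
    are centres of a cover; the sum of their costs 2^(-(s+t) u(x_i,n,e)) is at
    most 2^(-t d n) where d n is a lower bound of S_n u(x_i)
    ([short_centers_cost]), and this is summable in n.  The rate d depends on x,
    so Z is cut into countably many pieces on which it is constant, and the
    radius is shrunk with d so that S_n u varies little in a Bowen ball
    ([mBS_short_descriptions], [DimBS_short_descriptions]).

    Conversely, one oracle achieves equality.  For the scales 1/(k+1), choose
    near-optimal covers, countably many in all, with weights that have total sum
    at most 1.  Then at most 2^L members have weight at least 2^-L, so such a
    member is determined by L and an L-bit index; an oracle that tabulates this
    correspondence makes the dense point near its centre describable with
    L + O(log L) bits ([counting_oracle], [weighted_oracle]).  With L close to
    s u(y,n,e), which uniform continuity of u makes close to s S_n u(x_i), the
    complexity ratio at every covered point is nearly s; since S_n u(x_i) grows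
    linearly in n, all additive errors are negligible ([overhead],
    [covers_oracle]).  For Dim the cover depends on n; the extra factor
    2^(-n/(k+1)) makes the weights summable over n and only costs n/(k+1) bits
    ([point_Dim_le_DimBS]).

    The oracle has to act through a machine that is prefix-free for all oracles.
    [lookup_machine] provides it: the oracle marks codewords and tabulates their
    values, and the machine rejects an input that has a marked proper prefix. *)

(** * Functions computable with an oracle, and a prefix-free lookup machine *)

Arguments Cantor.to_nat : simpl never.
Arguments Cantor.of_nat : simpl never.

Local Notation cpair a b := (Cantor.to_nat (@pair nat nat a b)).
Local Notation cfst a := (Cantor.of_nat a).1.
Local Notation csnd a := (Cantor.of_nat a).2.

Lemma cpair_inj a b a' b' : cpair a b = cpair a' b' -> a = a' /\ b = b'.
Proof.
by move=> /(congr1 Cantor.of_nat); rewrite !Cantor.cancel_of_to => -[].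
Qed.

Lemma cpairK a : cpair (cfst a) (csnd a) = a.
Proof. by rewrite -[RHS]Cantor.cancel_to_of; case: (Cantor.of_nat a). Qed.

(** The program does not depend on the oracle: a prefix-free machine has to be
    prefix-free under every oracle. *)
Definition ocomputable (f : set nat -> nat -> nat) : Prop :=
  exists c, forall A a r, oeval A c a r <-> r = f A a.

Lemma eq_ocomputable f g : (forall A a, f A a = g A a) ->
  ocomputable f -> ocomputable g.
Proof. by move=> fg [c cP]; exists c => A a r; rewrite cP fg. Qed.

Lemma ocomputable_comp f g : ocomputable f -> ocomputable g ->
  ocomputable (fun A a => f A (g A a)).
Proof.
move=> [c cP] [d dP]; exists (OComp c d) => A a r /=; split.
  by move=> [b /dP -> /cP].
by move=> ->; exists (g A a); [exact/dP|exact/cP].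
Qed.

Lemma ocomputable_pair f g : ocomputable f -> ocomputable g ->
  ocomputable (fun A a => cpair (f A a) (g A a)).
Proof.
move=> [c cP] [d dP]; exists (OPair c d) => A a r /=; split.
  by move=> [p [q [/cP -> /dP -> ->]]].
by move=> ->; exists (f A a), (g A a); split=> //; [exact/cP|exact/dP].
Qed.

Lemma ocomputable_fst f : ocomputable f ->
  ocomputable (fun A a => cfst (f A a)).
Proof.
by move=> /(@ocomputable_comp (fun _ a => cfst a)); apply; exists OFst.
Qed.

Lemma ocomputable_snd f : ocomputable f ->
  ocomputable (fun A a => csnd (f A a)).
Proof.
by move=> /(@ocomputable_comp (fun _ a => csnd a)); apply; exists OSnd.
Qed.

Lemma ocomputable_succ f : ocomputable f -> ocomputable (fun A a => (f A a).+1).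
Proof.
by move=> /(@ocomputable_comp (fun _ a => a.+1)); apply; exists OSucc.
Qed.

Lemma ocomputable_query f : ocomputable f ->
  ocomputable (fun A a => nat_of_bool (f A a \in A)).
Proof.
by move=> /(@ocomputable_comp (fun A a => nat_of_bool (a \in A))); apply;
  exists OQuery.
Qed.

Lemma ocomputable_id : ocomputable (fun _ a => a).
Proof.
by exists (OPair OFst OSnd) => A a r /=; split=> [[p [q [-> -> ->]]]|->];
  [exact: cpairK|exists (cfst a), (csnd a); split=> //; rewrite cpairK].
Qed.

Lemma ocomputable_const n : ocomputable (fun _ _ => n).
Proof.
elim: n => [|n]; first by exists OZero.
exact: ocomputable_succ.
Qed.

Lemma ocomputable_prec f g : ocomputable f -> ocomputable g ->
  ocomputable (fun A a => nat_rect (fun=> nat) (f A (cfst a))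
    (fun k v => g A (cpair (cfst a) (cpair k v))) (csnd a)).
Proof.
move=> [c cP] [d dP]; exists (OPrec c d) => A a r /=.
elim: (csnd a) r => [|k IHk] r /=; first exact: cP.
split=> [[v /IHk -> /dP]//|->]; eexists; [exact/IHk|exact/dP].
Qed.

Lemma ocomputable_iter n s x :
    ocomputable n -> ocomputable s -> ocomputable x ->
  ocomputable (fun A a => iter (n A a) (s A) (x A a)).
Proof.
move=> cn cs cx.
have cs' : ocomputable (fun A z => s A (csnd (csnd z))).
  by apply: ocomputable_comp cs _; do 2 apply: ocomputable_snd;
    exact: ocomputable_id.
have := ocomputable_comp (ocomputable_prec ocomputable_id cs')
  (ocomputable_pair cx cn).
apply: eq_ocomputable => A a; rewrite Cantor.cancel_of_to /=.
by elim: (n A a) => //= k ->; rewrite !Cantor.cancel_of_to.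
Qed.

Lemma ocomputable_if b f g : ocomputable b -> ocomputable f -> ocomputable g ->
  ocomputable (fun A a => if b A a == 0%N then f A a else g A a).
Proof.
move=> cb cf cg.
have cg' : ocomputable (fun A z => g A (cfst z)).
  by apply: ocomputable_comp cg _; apply: ocomputable_fst;
    exact: ocomputable_id.
have := ocomputable_comp (ocomputable_prec cf cg')
  (ocomputable_pair ocomputable_id cb).
apply: eq_ocomputable => A a; rewrite !Cantor.cancel_of_to /=.
by case: (b A a) => //= k; rewrite Cantor.cancel_of_to.
Qed.

Lemma ocomputable_pred f : ocomputable f -> ocomputable (fun A a => (f A a).-1).
Proof.
move=> /(@ocomputable_comp (fun _ a => a.-1)); apply.
have cs : ocomputable (fun _ z => cfst (csnd z)).
  by apply: ocomputable_fst; apply: ocomputable_snd; exact: ocomputable_id.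
have := ocomputable_comp (ocomputable_prec (ocomputable_const 0) cs)
  (ocomputable_pair (ocomputable_const 0) ocomputable_id).
apply: eq_ocomputable => A a; rewrite Cantor.cancel_of_to /=.
by case: a => //= k; rewrite !Cantor.cancel_of_to.
Qed.

Lemma ocomputable_odd f : ocomputable f ->
  ocomputable (fun A a => nat_of_bool (odd (f A a))).
Proof.
move=> cf.
have cs : ocomputable (fun A a => if a == 0%N then 1%N else 0%N).
  by apply: (@ocomputable_if (fun _ a => a) (fun _ _ => 1%N) (fun _ _ => 0%N));
    [exact: ocomputable_id|exact: ocomputable_const|exact: ocomputable_const].
have := ocomputable_iter cf cs (ocomputable_const 0).
apply: eq_ocomputable => A a.
by elim: (f A a) => //= k ->; case: (odd k).
Qed.

Lemma ocomputable_half f : ocomputable f -> ocomputable (fun A a => (f A a)./2).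
Proof.
move=> cf.
have cid := ocomputable_id.
have cs : ocomputable (fun A z => if csnd z == 0%N then cpair (cfst z) 1
                                  else cpair (cfst z).+1 0).
  apply: (@ocomputable_if (fun _ z => csnd z) (fun _ z => cpair (cfst z) 1)
    (fun _ z => cpair (cfst z).+1 0)).
  - exact: ocomputable_snd.
  - by apply: ocomputable_pair (ocomputable_const 1); exact: ocomputable_fst.
  - apply: ocomputable_pair (ocomputable_const 0).
    by apply: ocomputable_succ; exact: ocomputable_fst.
have c0 := ocomputable_pair (ocomputable_const 0) (ocomputable_const 0).
have := ocomputable_fst (ocomputable_iter cf cs c0).
apply: eq_ocomputable => A a.
suff -> : iter (f A a) (fun z => if csnd z == 0%N then cpair (cfst z) 1
    else cpair (cfst z).+1 0) (cpair 0 0) = cpair (f A a)./2 (odd (f A a)).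
  by rewrite Cantor.cancel_of_to.
elim: (f A a) => // k IHk.
rewrite iterS IHk Cantor.cancel_of_to /= uphalf_half.
by case: (odd k).
Qed.

(** A string is turned into a number by pairing its bits one after another onto
    the state [q].  A scan from left to right passes through the numbers of all
    prefixes of its input, which the bijective binary coding would not give. *)
Definition str_id (q : nat) (t : seq bool) : nat :=
  foldl (fun q b => cpair q (nat_of_bool b).+1) q t.

Lemma str_id_rcons q t b : str_id q (rcons t b) = cpair (str_id q t) b.+1.
Proof. by rewrite /str_id -cats1 foldl_cat. Qed.

Lemma str_id_inj : injective (str_id 0).
Proof.
have pos t b : str_id 0 (rcons t b) <> 0%N.
  rewrite str_id_rcons => e.
  have [_ //] : str_id 0 t = 0%N /\ b.+1 = 0%N by apply: cpair_inj; rewrite e.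
elim/last_ind => [|t b IHt] t'; case/lastP: t' => [|t' b'] //.
- by move=> /esym /pos.
- by move=> /pos.
rewrite !str_id_rcons => /cpair_inj [/IHt -> [e]].
by congr rcons; case: b b' e => [] [].
Qed.

(** The state is <number of the prefix read, <code of the unread suffix, flag>>.
    The flag becomes 1 when a string that has a further bit is marked by the
    oracle, so at the end it tells whether a proper prefix is marked.  An empty
    suffix has code 0, and further steps leave the state unchanged. *)
Definition scan_step (A : set nat) (z : nat) : nat :=
  if cfst (csnd z) == 0%N then z else
  cpair (cpair (cfst z) (odd (cfst (csnd z)).-1).+1)
    (cpair (cfst (csnd z)).-1./2
      (if nat_of_bool (cpair 0 (cfst z) \in A) == 0%N then csnd (csnd z) else 1)).

Lemma ocomputable_scan_step : ocomputable scan_step.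
Proof.
have cid := ocomputable_id.
have c1 : ocomputable (fun _ z => cfst z) by exact: ocomputable_fst.
have c2 : ocomputable (fun _ z => cfst (csnd z)).
  by apply: ocomputable_fst; exact: ocomputable_snd.
have c3 : ocomputable (fun _ z => csnd (csnd z)).
  by do 2 apply: ocomputable_snd.
apply: (@ocomputable_if _ _ (fun A z => cpair (cpair _ _) (cpair _ _))) => //.
apply: ocomputable_pair; first apply: ocomputable_pair => //.
  apply: ocomputable_succ; apply: ocomputable_odd; exact: ocomputable_pred.
apply: ocomputable_pair.
  by apply: ocomputable_half; exact: ocomputable_pred.
apply: (@ocomputable_if (fun A z => nat_of_bool (cpair 0 (cfst z) \in A))).
- apply: ocomputable_query; apply: ocomputable_pair => //.
  exact: ocomputable_const.
- exact: c3.
- exact: ocomputable_const.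
Qed.

Fixpoint met_mark (A : set nat) (q : nat) (t : seq bool) (m : nat) : nat :=
  if t is b :: t' then
    met_mark A (cpair q b.+1) t' (if cpair 0 q \in A then 1%N else m)
  else m.

Lemma met_mark0 A q t m : met_mark A q t m = 0%N <->
  m = 0%N /\ forall l, (l < size t)%N -> cpair 0 (str_id q (take l t)) \notin A.
Proof.
elim: t q m => [|b t IHt] q m /=; first by split=> [->|[]].
rewrite IHt; split=> [[+ h]|[-> h]].
  case: ifPn => // qA m0; split=> // -[|l] lt //=.
  by rewrite /= ltnS in lt; rewrite /str_id /=; exact: h.
have := h 0%N isT; rewrite /str_id /= => /negbTE ->; split=> // l lt.
exact: (h l.+1).
Qed.

Lemma iter_scan_step A q t m k : (size t <= k)%N ->
  iter k (scan_step A) (cpair q (cpair (nat_of_str t) m)) =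
  cpair (str_id q t) (cpair 0 (met_mark A q t m)).
Proof.
elim: k t q m => [|k IHk] t q m; first by rewrite leqn0 size_eq0 => /eqP ->.
case: t => [_|b t]; rewrite iterSr.
  by rewrite {2}/scan_step !Cantor.cancel_of_to /= (IHk [::]).
rewrite /= ltnS => tk; rewrite {2}/scan_step !Cantor.cancel_of_to /=.
have -> : odd (b + (nat_of_str t).*2) = b by rewrite oddD odd_double addbF; case: b.
have -> : (b + (nat_of_str t).*2)./2 = nat_of_str t by rewrite half_bit_double.
by rewrite IHk //; case: (_ \in A).
Qed.

Lemma size_le_nat_of_str t : (size t <= nat_of_str t)%N.
Proof. by elim: t => //= b t; case: b; lia. Qed.

(** The code of a string is at least its length, so it serves as the number of
    steps. *)
Definition scan (A : set nat) (a : nat) : nat :=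
  iter (cfst a) (scan_step A) (cpair 0 (cpair (cfst a) 0)).

(** The oracle is read as two tables: <0, p> in [A] marks the prefix number [p]
    as a codeword, and <1, <t, r>> in [A] gives the codeword [t] the value [r].
    The result 0 means acceptance, as unbounded search requires. *)
Definition lookup (A : set nat) (a : nat) : nat :=
  if csnd (csnd (scan A a)) == 0%N then
    if nat_of_bool (cpair 0 (cfst (scan A a)) \in A) == 0%N then 1%N
    else if nat_of_bool (cpair 1 a \in A) == 0%N then 1%N else 0%N
  else 1%N.

Lemma ocomputable_lookup : ocomputable lookup.
Proof.
have cid := ocomputable_id; have cc := ocomputable_const.
have c0 := ocomputable_pair.
have cs : ocomputable scan.
  apply: ocomputable_iter (ocomputable_scan_step) _; first exact: ocomputable_fst.
  do 2 apply: ocomputable_pair => //; exact: ocomputable_fst.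
apply: (@ocomputable_if (fun A a => csnd (csnd (scan A a)))
  (fun A a => if nat_of_bool (cpair 0 (cfst (scan A a)) \in A) == 0%N then 1%N
    else if nat_of_bool (cpair 1 a \in A) == 0%N then 1%N else 0%N)) => //.
  by do 2 apply: ocomputable_snd.
apply: (@ocomputable_if (fun A a => nat_of_bool (cpair 0 (cfst (scan A a)) \in A))
  (fun _ _ => 1%N) (fun A a => if nat_of_bool (cpair 1 a \in A) == 0%N then 1%N
  else 0%N)) => //.
  apply: ocomputable_query; apply: ocomputable_pair => //.
  exact: ocomputable_fst.
apply: (@ocomputable_if (fun A a => nat_of_bool (cpair 1 a \in A))
  (fun _ _ => 1%N) (fun _ _ => 0%N)) => //.
by apply: ocomputable_query; apply: ocomputable_pair.
Qed.

Lemma lookup0P A t r : lookup A (cpair (nat_of_str t) r) = 0%N <->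
  [/\ cpair 0 (str_id 0 t) \in A,
      forall l, (l < size t)%N -> cpair 0 (str_id 0 (take l t)) \notin A
    & cpair 1 (cpair (nat_of_str t) r) \in A].
Proof.
rewrite /lookup /scan Cantor.cancel_of_to /= iter_scan_step ?size_le_nat_of_str //.
rewrite !Cantor.cancel_of_to /=; have := met_mark0 A 0 t 0.
case: eqP => [e [/(_ e) [_ h] _]|ne [_ h]]; last first.
  by split=> // -[_ h' _]; case: ne; exact: h.
by do 2 case: (_ \in A); split=> // -[].
Qed.

(** Unbounded search for an accepted value.  Prefix-freeness holds for every
    oracle, including those that mark a set of strings that is not prefix-free,
    because a marked proper prefix blocks acceptance.  A prefix-free table [D] is
    written into the oracle without loss. *)
Lemma lookup_machine : exists M, prefix_free_machine M /\
  forall D : seq bool -> nat -> Prop,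
    (forall t t' r r', D t r -> D t' r' -> prefix t t' -> t = t' /\ r = r') ->
  exists A, forall t r, D t r -> oeval A M (nat_of_str t) r.
Proof.
have [c cP] := ocomputable_lookup; exists (OMin c); split.
  move=> A t t' [r [/cP/esym/lookup0P[tA _ _] _]].
  move=> [r' [/cP/esym/lookup0P[_ h _] _]] /prefixP[w e].
  case: w e => [|b w] e; first by rewrite e cats0.
  have := h (size t); rewrite e size_cat /= -addSnnS leq_addr take_size_cat //.
  by move=> /(_ isT); rewrite tA.
move=> D Dfun.
pose A : set nat := [set a | (exists t r, D t r /\ a = cpair 0 (str_id 0 t)) \/
  exists t r, D t r /\ a = cpair 1 (cpair (nat_of_str t) r)].
have A0 t : cpair 0 (str_id 0 t) \in A <-> exists r, D t r.
  rewrite inE /A /=; split=> [|[r Dtr]]; last by left; exists t, r.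
  case=> [[t' [r [Dtr /cpair_inj [_ /str_id_inj ->]]]]|]; first by exists r.
  by move=> [t' [r [_ /cpair_inj[]]]].
have A1 t r : cpair 1 (cpair (nat_of_str t) r) \in A <-> D t r.
  rewrite inE /A /=; split=> [|Dtr]; last by right; exists t, r.
  case=> [[t' [r' [_ /cpair_inj[]//]]]|].
  by move=> [t' [r' [Dtr /cpair_inj[_ /cpair_inj[/nat_of_str_inj -> ->]]]]].
have pre t r : D t r ->
    forall l, (l < size t)%N -> cpair 0 (str_id 0 (take l t)) \notin A.
  move=> Dtr l lt; apply/negP => /A0 [r' Dr'].
  have [e _] := Dfun _ _ _ _ Dr' Dtr (prefix_take t l).
  by move: lt; rewrite -{1}e size_take; case: ifP; rewrite ?ltnn // => ->.
exists A => t r Dtr /=; split.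
  apply/cP/esym/lookup0P; split; [by apply/A0; exists r|exact: pre Dtr|exact/A1].
move=> k kr; exists (lookup A (cpair (nat_of_str t) k)).-1; apply/cP.
rewrite prednK // lt0n; apply/eqP => /lookup0P [_ _ /A1 Dtk].
by have [_ e] := Dfun _ _ _ _ Dtr Dtk (prefix_refl t); rewrite e ltnn in kr.
Qed.

(** * Codes of sets of bounded cardinality *)

Lemma prefix_cat_eqsize (b b' w w' : seq bool) : size b = size b' ->
  prefix (b ++ w) (b' ++ w') -> b = b' /\ prefix w w'.
Proof.
move=> sb /prefixP[z] /eqP; rewrite -catA eqseq_cat; last by rewrite sb.
by move=> /andP[/eqP -> /eqP ->]; split=> //; exact: prefix_prefix.
Qed.

(** Self-delimiting code of [L]: the length of its binary expansion in unary, a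
    zero, the expansion.  It costs only O(log L) bits. *)
Definition length_header (L : nat) : seq bool :=
  nseq (size (str_of_nat L)) true ++ false :: str_of_nat L.

Lemma prefix_length_header L L' w w' :
  prefix (length_header L ++ w) (length_header L' ++ w') ->
  L = L' /\ prefix w w'.
Proof.
rewrite /length_header -!catA.
have unary m m' x x' : prefix (nseq m true ++ false :: x)
    (nseq m' true ++ false :: x') -> m = m' /\ prefix x x'.
  by elim: m m' => [|m IHm] [|m'] //= /IHm [-> ?].
by move=> /unary[sL] /(prefix_cat_eqsize sL) [/(can_inj str_of_natK) -> ?].
Qed.

Lemma expn_size_str t : (2 ^ size t <= (nat_of_str t).+1)%N.
Proof.
by elim: t => //= b t IHt; rewrite expnS; case: b; lia.
Qed.

Lemma sqr_le_expn m : (m * m <= 4 * 2 ^ m)%N.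
Proof.
elim: m => // m IHm; rewrite expnS.
by have := ltn_expl m (isT : 1 < 2)%N; lia.
Qed.

(** For m the binary length of L, m^2 = O(L), so 2 m <= eta L + O(1) by the
    inequality between arithmetic and geometric means. *)
Lemma length_header_cost (R : realType) (eta : R) : 0 < eta ->
  exists c : R, forall L, (size (length_header L) + L)%:R <= (1 + eta) * L%:R + c.
Proof.
move=> eta0; exists (1 + eta + 4 / eta) => L.
rewrite /length_header size_cat size_nseq /=; set m := size _.
have mL : (m * m <= 4 * L.+1)%N.
  rewrite (leq_trans (sqr_le_expn m)) // leq_mul2l /=.
  by have := expn_size_str (str_of_nat L); rewrite str_of_natK.
have {}mL : m%:R ^+ 2 <= 4 * (L%:R + 1) :> R.
  by rewrite expr2 -natrM natr1 -natrM ler_nat.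
have -> : (m + m.+1 + L)%:R = 2 * m%:R + 1 + L%:R :> R.
  by rewrite !natrD -natr1; ring.
have : 2 * m%:R <= eta / 4 * m%:R ^+ 2 + 4 / eta.
  rewrite -subr_ge0.
  have -> : eta / 4 * m%:R ^+ 2 + 4 / eta - 2 * m%:R =
      (eta * m%:R / 2 - 2) ^+ 2 / eta :> R by field; rewrite gt_eqF.
  by rewrite divr_ge0 ?sqr_ge0 ?ltW.
have : eta / 4 * m%:R ^+ 2 <= eta / 4 * (4 * (L%:R + 1)).
  by rewrite ler_wpM2l // divr_ge0 // ltW.
have -> : eta / 4 * (4 * (L%:R + 1)) = eta * (L%:R + 1) by field.
by lra.
Qed.

Definition bitword (L r : nat) : seq bool :=
  nth [::] [seq val t | t <- enum {: L.-tuple bool}] r.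

Lemma size_bitwords L :
  size [seq val t | t <- enum {: L.-tuple bool}] = (2 ^ L)%N.
Proof. by rewrite size_map -cardE card_tuple card_bool. Qed.

Lemma size_bitword L r : (r < 2 ^ L)%N -> size (bitword L r) = L.
Proof.
rewrite -size_bitwords => /(mem_nth [::]) /mapP[t _].
by rewrite /bitword => ->; exact: size_tuple.
Qed.

Lemma bitword_inj L r r' : (r < 2 ^ L)%N -> (r' < 2 ^ L)%N ->
  bitword L r = bitword L r' -> r = r'.
Proof.
rewrite -size_bitwords => rL r'L /eqP; rewrite nth_uniq //; first by move/eqP.
by rewrite map_inj_uniq ?enum_uniq //; exact: val_inj.
Qed.

Lemma complexity_le U A t i : oeval A U (nat_of_str t) i ->
  (complexity_nat U A i <= size t)%N.
Proof.
move=> Ut; rewrite /complexity_nat /complexity; case: pselect => // h.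
case: ex_minnP => m _; apply; apply/asboolP; exists t => //.
by rewrite /orun str_of_natK.
Qed.

(** Prefix-free codes are realised by oracles up to the header by which [U]
    simulates the lookup machine. *)
Lemma lookup_complexity U : universal_prefix_free U -> exists h : seq bool,
  forall D : seq bool -> nat -> Prop,
    (forall t t' r r', D t r -> D t' r' -> prefix t t' -> t = t' /\ r = r') ->
  exists A, forall t i, D t i -> (complexity_nat U A i <= size h + size t)%N.
Proof.
move=> [_ Uuniv]; have [M [Mpf Mlookup]] := lookup_machine.
have [h hP] := Uuniv M Mpf; exists h => D Dfun.
have [A AP] := Mlookup D Dfun; exists A => t i /AP Dti.
rewrite -size_cat; apply: complexity_le.
by have := hP A t (str_of_nat i); rewrite /orun str_of_natK => /iffRL; apply.
Qed.

(** Finiteness of [V] and the bound at once; in terms of lists, it can be read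
    off directly from finite sums of weights. *)
Definition at_most (n : nat) (V : set nat) : Prop :=
  forall s : seq nat, uniq s -> (forall i, i \in s -> V i) -> (size s <= n)%N.

Definition rank_in (V : set nat) (i : nat) : nat :=
  count (fun j => j \in V) (iota 0 i).

Lemma rank_in_ltn V i j : V i -> (i < j)%N -> (rank_in V i < rank_in V j)%N.
Proof.
move=> Vi ij; have -> : j = (i + (j - i.+1).+1)%N by lia.
rewrite /rank_in iotaD count_cat add0n /= -[X in (X < _)%N]addn0 ltn_add2l.
by rewrite mem_set.
Qed.

Lemma rank_in_inj V i j : V i -> V j -> rank_in V i = rank_in V j -> i = j.
Proof.
move=> Vi Vj e; case: (ltngtP i j) => // ij.
  by have := rank_in_ltn Vi ij; rewrite e ltnn.
by have := rank_in_ltn Vj ij; rewrite e ltnn.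
Qed.

Lemma rank_in_bound n V i : at_most n V -> V i -> (rank_in V i < n)%N.
Proof.
move=> Vn Vi; apply: leq_trans (rank_in_ltn Vi (ltnSn i)) _.
rewrite /rank_in -size_filter; apply: Vn; first by rewrite filter_uniq ?iota_uniq.
by move=> j; rewrite mem_filter => /andP[/set_mem].
Qed.

(** An element of [V L] is described by the header of [L] followed by its rank
    in [V L], written with exactly [L] bits; the fixed length of the second part
    makes the code prefix-free. *)
Lemma counting_oracle (R : realType) U (V : nat -> set nat) :
  universal_prefix_free U -> (forall L, at_most (2 ^ L) (V L)) ->
  exists A, forall eta : R, 0 < eta -> exists c : R, forall L i, V L i ->
    (complexity_nat U A i)%:R <= (1 + eta) * L%:R + c.
Proof.
move=> Uuniv V2; have [h hP] := lookup_complexity Uuniv.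
pose D t i := exists2 L, V L i
  & t = length_header L ++ bitword L (rank_in (V L) i).
have [|A AP] := hP D.
  move=> t t' r r' [L VLr ->] [L' VLr' ->].
  move=> /prefix_length_header[LL']; subst L'.
  have rL := rank_in_bound (V2 L) VLr; have rL' := rank_in_bound (V2 L) VLr'.
  rewrite prefixE size_bitword // -{1}(size_bitword rL') take_size => /eqP e.
  have <- : r = r'; last by [].
  by apply: rank_in_inj VLr VLr' _; exact: bitword_inj rL rL' _.
exists A => eta eta0; have [c cP] := length_header_cost eta0.
exists (c + (size h)%:R) => L i VLi.
have /AP : D (length_header L ++ bitword L (rank_in (V L) i)) i by exists L.
rewrite size_cat size_bitword ?rank_in_bound // -(ler_nat R) natrD.
move=> /le_trans; apply.
by have := cP L; lra.
Qed.

(** * Kraft's inequality for the complexity *)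

Lemma oeval_fun A c a r r' : oeval A c a r -> oeval A c a r' -> r = r'.
Proof.
elim: c a r r' => [|||||f IHf g IHg|f IHf g IHg|f IHf g IHg|f IHf] a r r' /=;
  try by move=> -> ->.
- move=> [p [q [fp gq ->]]] [p' [q' [fp' gq' ->]]].
  by rewrite (IHf _ _ _ fp fp') (IHg _ _ _ gq gq').
- move=> [b gb fb] [b' gb' fb']; rewrite (IHg _ _ _ gb' gb) in fb'.
  exact: IHf fb fb'.
- elim: (Cantor.of_nat a).2 r r' => [|k IHk] r r'; first exact: IHf.
  move=> [v kv gv] [v' kv' gv']; rewrite (IHk _ _ kv' kv) in gv'.
  exact: IHg gv gv'.
- move=> [f0 fS] [f0' fS']; case: (ltngtP r r') => // [/fS'|/fS] [v].
    by move=> /(IHf _ _ _ f0).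
  by move=> /(IHf _ _ _ f0').
Qed.

(** Describability of every number by [U] cannot come from a table in the
    oracle, since the oracle is given here.  This machine halts on the empty
    string only: the unbounded search tests whether its input is 0. *)
Lemma const_machine i : exists2 M, prefix_free_machine M &
  forall A, oeval A M 0%N i.
Proof.
have [c cP] := ocomputable_const i.
exists (OComp c (OMin OFst)); last first.
  move=> A /=; exists 0%N; last exact/cP.
  by rewrite Cantor.cancel_of_to.
move=> A t t' [r [b [tb _] _]] [r' [b' [tb' _] _]].
move: tb tb'; rewrite /= !Cantor.cancel_of_to /= => tb tb' _.
by apply: nat_of_str_inj; rewrite -tb -tb'.
Qed.

Lemma complexity_witness U A i : universal_prefix_free U ->
  exists2 t, size t = complexity_nat U A i & oeval A U (nat_of_str t) i.
Proof.
move=> [_ Uuniv]; rewrite /complexity_nat /complexity; case: pselect => [h|[]].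
  case: ex_minnP => m /asboolP[t <- Ut] _; exists t => //.
  by move: Ut; rewrite /orun str_of_natK.
have [M /Uuniv[h hP] Mi] := const_machine i.
exists (size (h ++ [::])); apply/asboolP; exists (h ++ [::]) => //.
by apply/(hP A [::]); rewrite /orun str_of_natK; exact: Mi.
Qed.

(** Induction on the maximal length: a code without the empty word splits by
    the first bit into two codes of shorter words, each counted with weight
    1/2, and a prefix-free code with the empty word has no other element. *)
Lemma kraft (R : realType) (s : seq (seq bool)) : uniq s ->
  {in s &, forall t t', prefix t t' -> t = t'} ->
  \sum_(t <- s) 2^-1 ^+ size t <= 1 :> R.
Proof.
have with_nil (r : seq (seq bool)) : {in r &, forall t t', prefix t t' -> t = t'} ->
    uniq r -> [::] \in r -> \sum_(t <- r) 2^-1 ^+ size t <= 1 :> R.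
  move=> pf ur r0; rewrite (_ : \sum_(t <- r) _ = \sum_(t <- r) 1).
    rewrite big_const_seq count_predT iter_addr_0 lern1.
    apply: (@uniq_leq_size _ r [:: [::]]) => // t tr.
    by rewrite inE -(pf _ _ r0 tr) ?prefix0s.
  by apply: eq_big_seq => t tr; rewrite -(pf _ _ r0 tr) ?prefix0s.
have [m] : exists m, all (fun t => size t <= m)%N s.
  exists (\max_(t <- s) size t); apply/allP => t ts.
  exact: leq_bigmax_seq.
elim: m s => [|m IHm] s sm us pf; have [s0|s0] := boolP ([::] \in s);
  try exact: with_nil.
  case: s sm us pf s0 => [|t s] /=; first by rewrite big_nil.
  by rewrite leqn0 size_eq0 => /andP[/eqP -> _].
pose sub b := [seq behead t | t <- s & head false t == b].
have cons t : t \in s -> t = head false t :: behead t.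
  by case: t => // ts; rewrite ts in s0.
have half b : \sum_(t <- sub b) 2^-1 ^+ size t <= 1 :> R.
  apply: IHm.
  - apply/allP => ? /mapP[t]; rewrite mem_filter => /andP[_ ts] ->.
    by have := allP sm _ ts; rewrite {1}(cons _ ts).
  - rewrite map_inj_in_uniq ?filter_uniq // => t t'.
    rewrite !mem_filter => /andP[/eqP tb ts] /andP[/eqP tb' ts'] e.
    by rewrite (cons _ ts) (cons _ ts') tb tb' e.
  - move=> ? ? /mapP[t tm ->] /mapP[t' tm' ->].
    move: tm tm'; rewrite !mem_filter => /andP[/eqP tb ts] /andP[/eqP tb' ts'] e.
    rewrite (pf t t') // (cons _ ts) (cons _ ts') tb tb' /= eqxx.
    exact: e.
have split_b b : \sum_(t <- s | head false t == b) 2^-1 ^+ size t =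
    2^-1 * \sum_(t <- sub b) 2^-1 ^+ size t :> R.
  rewrite big_map big_filter mulr_sumr big_seq_cond [RHS]big_seq_cond.
  by apply: eq_bigr => t /andP[ts _]; rewrite {1}(cons _ ts) exprS.
rewrite (bigID (fun t => head false t == true)) /= split_b.
rewrite (eq_bigl (fun t => head false t == false)); last first.
  by move=> t; case: (head false t).
by rewrite split_b; have := half true; have := half false; lra.
Qed.

Lemma complexity_kraft (R : realType) U A (s : seq nat) :
  universal_prefix_free U -> uniq s ->
  \sum_(i <- s) 2^-1 ^+ complexity_nat U A i <= 1 :> R.
Proof.
move=> Uuniv us.
have /choice[t tP] : forall i, exists t, size t = complexity_nat U A i /\
    oeval A U (nat_of_str t) i.
  by move=> i; have [t ? ?] := complexity_witness A i Uuniv; exists t.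
rewrite (eq_bigr (fun i => 2^-1 ^+ size (t i))); last first.
  by move=> i _; rewrite (tP i).1.
rewrite -(big_map t predT (fun t => 2^-1 ^+ size t)); apply: kraft.
  rewrite map_inj_uniq // => i j e; have := (tP j).2; rewrite -e.
  exact: oeval_fun (tP i).2.
move=> ? ? /mapP[i _ ->] /mapP[j _ ->]; apply: Uuniv.1.
  by exists i; exact: (tP i).2.
by exists j; exact: (tP j).2.
Qed.

(** * Limits of extended reals *)

Section ExtendedLimits.
Context {R : realType}.
Implicit Types (f : nat -> \bar R) (g : R -> \bar R) (l : \bar R).

Lemma sup_einfs f : limn_einf f = ereal_sup (range (einfs f)).
Proof. by rewrite limn_einf_lim; apply: cvg_lim => //; exact: cvg_einfs_sup. Qed.

Lemma inf_esups f : limn_esup f = ereal_inf (range (esups f)).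
Proof. by rewrite limn_esup_lim; apply: cvg_lim => //; exact: cvg_esups_inf. Qed.

Lemma limn_einf_lt f l : (limn_einf f < l)%E ->
  forall N, exists2 n, (N <= n)%N & (f n < l)%E.
Proof.
rewrite sup_einfs => fl N.
have : (einfs f N < l)%E.
  by apply: le_lt_trans fl; apply: ereal_sup_ubound; exists N.
by move=> /ereal_inf_lt[_ [n /= Nn <-] fnl]; exists n.
Qed.

Lemma limn_einf_le f l :
  (forall N, exists2 n, (N <= n)%N & (f n <= l)%E) -> (limn_einf f <= l)%E.
Proof.
move=> h; rewrite sup_einfs; apply: ge_ereal_sup => _ [N _ <-].
have [n Nn fnl] := h N; apply: le_trans fnl; apply: ereal_inf_lbound.
by exists n.
Qed.

Lemma lt_limn_einf f l : (l < limn_einf f)%E ->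
  exists N, forall n, (N <= n)%N -> (l < f n)%E.
Proof.
rewrite sup_einfs => /ereal_sup_gt[_ [N _ <-] lN]; exists N => n Nn.
by apply: lt_le_trans lN _; apply: ereal_inf_lbound; exists n.
Qed.

Lemma limn_esup_lt f l : (limn_esup f < l)%E ->
  exists N, forall n, (N <= n)%N -> (f n < l)%E.
Proof.
rewrite inf_esups => /ereal_inf_lt[_ [N _ <-] lN]; exists N => n Nn.
by apply: le_lt_trans lN; apply: ereal_sup_ubound; exists n.
Qed.

Lemma limn_esup_le f l N :
  (forall n, (N <= n)%N -> (f n <= l)%E) -> (limn_esup f <= l)%E.
Proof.
move=> h; rewrite inf_esups; apply: (@le_trans _ _ (esups f N)).
  by apply: ereal_inf_lbound; exists N.
by apply: ge_ereal_sup => _ [n /= Nn <-]; exact: h.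
Qed.

Definition antitone_pos g : Prop :=
  forall e e', 0 < e -> e <= e' -> (g e' <= g e)%E.

(** All dimensions are limits for e -> 0 of functions that grow as e decreases;
    this turns the limits into suprema. *)
Lemma right_lim_sup g : antitone_pos g ->
  lim (g e @[e --> 0^'+]) = ereal_sup [set g e | e in [set e | 0 < e]].
Proof.
move=> ag; apply: cvg_lim => //.
have -> : [set e : R | 0 < e] = [set` Interval (BRight 0) +oo%O].
  by apply/seteqP; split=> e /=; rewrite in_itv /= andbT.
apply: nonincreasing_at_right_cvge => // e e'.
by rewrite !in_itv /= !andbT => e0 _; exact: ag.
Qed.

Lemma right_lim_ge g e : antitone_pos g -> 0 < e ->
  (g e <= lim (g x @[x --> 0^'+]))%E.
Proof.
by move=> ag e0; rewrite right_lim_sup //; apply: ereal_sup_ubound; exists e.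
Qed.

Lemma right_lim_le g l : antitone_pos g ->
  (forall e, 0 < e -> exists e', [/\ 0 < e', e' <= e & (g e' <= l)%E]) ->
  (lim (g e @[e --> 0^'+]) <= l)%E.
Proof.
move=> ag h; rewrite right_lim_sup //; apply: ge_ereal_sup => _ [e /= e0 <-].
by have [e' [e'0 e'e gl]] := h e e0; apply: le_trans (ag _ _ _ _) gl.
Qed.

(** The second parameter t leaves room for the loss of a small exponent, which
    the covers of the lower dimension need. *)
Lemma le_of_real_gt (x y : \bar R) : (0 <= x)%E ->
  (forall s t : R, (x < s%:E)%E -> 0 < t -> (y <= (s + t)%:E)%E) -> (y <= x)%E.
Proof.
case: x => [x| |] //; last by move=> _ _; exact: leey.
move=> _ h; apply/lee_addgt0Pr => e e0.
have := h (x + e / 2) (e / 2); rewrite lte_fin ltrDl divr_gt0 // => /(_ isT isT).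
by rewrite -addrA -splitr.
Qed.

End ExtendedLimits.

Definition mesh {R : realType} (k : nat) : R := k.+1%:R^-1.

Lemma mesh_gt0 (R : realType) k : 0 < mesh k :> R.
Proof. by rewrite invr_gt0. Qed.

Lemma mesh_small (R : realType) (e : R) : 0 < e ->
  exists k0, forall k, (k0 <= k)%N -> mesh k + mesh k <= e.
Proof.
move=> e0; have [k0] := ltr_add_invr (divr_gt0 e0 (ltr0n R 2)).
rewrite add0r => k0e; exists k0 => k k0k.
have kk0 : mesh k <= mesh k0 :> R.
  by rewrite lef_pV2 ?posrE ?ltr0n // ler_nat.
have /ltW : mesh k0 < e / 2 by [].
lra.
Qed.

(** * Bowen balls and Birkhoff sums *)

Section Bowen.
Context {R : realType} {X : metricType R}.
Variables (T : X -> X) (u : X -> R).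
Implicit Types (x y z : X) (n : nat) (e d s : R).

Lemma bowen_ball_center n x e : 0 < e -> bowen_ball T n x e x.
Proof. by move=> e0 i _; rewrite mdistxx. Qed.

Lemma bowen_ball_sym n x y e : bowen_ball T n x e y -> bowen_ball T n y e x.
Proof. by move=> xy i ni; rewrite metric_sym; exact: xy. Qed.

Lemma bowen_ball_triangle n x y z e e' :
  bowen_ball T n x e y -> bowen_ball T n y e' z -> bowen_ball T n x (e + e') z.
Proof.
move=> xy yz i ni; apply: le_lt_trans (metric_triangle _ (iter i T y) _) _.
by apply: ltrD; [exact: xy|exact: yz].
Qed.

Lemma sub_bowen_ball n x e e' : e <= e' ->
  bowen_ball T n x e `<=` bowen_ball T n x e'.
Proof. by move=> ee' y xy i ni; apply: lt_le_trans (xy i ni) ee'. Qed.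

Lemma nbhs_bowen_ball n x e : continuous T -> 0 < e ->
  nbhs x (bowen_ball T n x e).
Proof.
move=> Tcont e0; elim: n => [|n IHn].
  by apply: filterS filterT => y _ i.
have Tn : {for x, continuous (iter n T)}.
  elim: n {IHn} => [|n IHn]; first exact: cvg_id.
  by apply: (@continuous_comp _ _ _ (iter n T) T) => //; exact: Tcont.
have : nbhs x (iter n T @^-1` ball (iter n T x) e).
  by apply: Tn; exact: nbhsx_ballx.
apply: filterS2 IHn => y xy; rewrite /= ballEmdist /= => xyn i.
by rewrite ltnS leq_eqVlt => /orP[/eqP -> //|]; exact: xy.
Qed.

Lemma dense_bowen_ball (xs : nat -> X) n x e : continuous T ->
  dense (range xs) -> 0 < e -> exists i, bowen_ball T n x e (xs i).
Proof.
move=> Tcont xs_dense e0; have xB := nbhs_bowen_ball n x Tcont e0.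
have [|z [/= zB [i _ iz]]] := xs_dense _ _ (open_interior (bowen_ball T n x e)).
  by exists x.
by exists i; rewrite iz; exact: interior_subset.
Qed.

(** One-sided, which suffices because the distance is symmetric. *)
Definition modulus e d : Prop := forall x y, mdist x y < e -> u x <= u y + d.

Lemma modulus_exists d : unif_continuous u -> 0 < d ->
  exists2 e, 0 < e & modulus e d.
Proof.
move=> /unif_continuousP uc d0; have [e e0 he] := uc d d0.
exists e => // x y xy; have := he (x, y); rewrite /= ballEmdist /= => /(_ xy).
by rewrite /ball /= => h; have := ler_norm (u x - u y); lra.
Qed.

Lemma birkhoff_sum_near e d n x y : modulus e d -> bowen_ball T n x e y ->
  birkhoff_sum T u n x <= birkhoff_sum T u n y + d *+ n.
Proof.
move=> md xy; have -> : d *+ n = \sum_(k < n) d by rewrite sumr_const card_ord.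
rewrite /birkhoff_sum -big_split /=.
by apply: ler_sum => i _; apply: md; exact: xy.
Qed.

Lemma bowen_sup_ge n x e : 0 < e ->
  ((birkhoff_sum T u n x)%:E <= bowen_sup T u n x e)%E.
Proof.
move=> e0; apply: ereal_sup_ubound; exists x => //; exact: bowen_ball_center.
Qed.

(** Two points of a Bowen ball of radius e are at distance below 2e along the
    orbit, whence the doubled radius in the modulus.  In particular the
    supremum is finite for small e. *)
Lemma bowen_sup_le e d n x z : modulus (e + e) d -> bowen_ball T n x e z ->
  (bowen_sup T u n x e <= (birkhoff_sum T u n z + d *+ n)%:E)%E.
Proof.
move=> md xz; apply: ge_ereal_sup => _ [y xy <-]; rewrite lee_fin.
apply: birkhoff_sum_near md _; apply: bowen_ball_triangle xz.
exact: bowen_ball_sym.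
Qed.

Lemma pow2e_ge0 (v : \bar R) : (0 <= pow2e v)%E.
Proof. by case: v => [r| |] //=; rewrite lee_fin powR_ge0. Qed.

Lemma le_pow2e (v w : \bar R) : (v <= w)%E -> (pow2e v <= pow2e w)%E.
Proof.
case: v w => [r| |] [r'| |] //=; rewrite ?leey // ?leNye // ?lee_fin.
by move=> ?; apply: ler_powR => //; rewrite ler1n.
Qed.

Lemma le_pow2eN s (v w : \bar R) : 0 <= s -> (v <= w)%E ->
  (pow2e (- s%:E * w) <= pow2e (- s%:E * v))%E.
Proof. by move=> s0 vw; apply: le_pow2e; rewrite !mulNe leeN2 lee_wpmul2l. Qed.

Lemma le_bowen_sup n x e e' : e <= e' ->
  (bowen_sup T u n x e <= bowen_sup T u n x e')%E.
Proof.
move=> ee'; apply: ge_ereal_sup => _ [y xy <-]; apply: ereal_sup_ubound.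
by exists y => //; exact: sub_bowen_ball xy.
Qed.

End Bowen.

(** * Dependence of the dimensions on the radius *)

Section Dims.
Context {R : realType} {X : metricType R}.
Variables (T : X -> X) (u : X -> R).
Implicit Types (x y z : X) (n : nat) (e d s : R) (Z : set X).

Lemma le_limn_einf (f g : nat -> \bar R) : (forall n, f n <= g n)%E ->
  (limn_einf f <= limn_einf g)%E.
Proof.
move=> fg; rewrite !sup_einfs; apply: ge_ereal_sup => _ [N _ <-].
apply: (@le_trans _ _ (einfs g N)); last by apply: ereal_sup_ubound; exists N.
apply: le_ereal_inf_tmp => _ [n /= Nn <-]; apply: le_trans (fg n).
by apply: ereal_inf_lbound; exists n.
Qed.

Lemma le_limn_esup (f g : nat -> \bar R) : (forall n, f n <= g n)%E ->
  (limn_esup f <= limn_esup g)%E.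
Proof.
move=> fg; rewrite !inf_esups; apply: le_ereal_inf_tmp => _ [N _ <-].
apply: (@le_trans _ _ (esups f N)); first by apply: ereal_inf_lbound; exists N.
apply: ge_ereal_sup => _ [n /= Nn <-]; apply: le_trans (fg n) _.
by apply: ereal_sup_ubound; exists n.
Qed.

Lemma complexity_ratio_antitone xs U A x n :
  antitone_pos (fun e => complexity_ratio xs U A T u x e n).
Proof.
move=> e e' _ ee'; apply: le_ereal_inf_tmp => _ [i /= xi <-].
by apply: ereal_inf_lbound; exists i => //=; exact: sub_bowen_ball xi.
Qed.

Lemma point_dim_at_antitone xs U A x :
  antitone_pos (fun e => point_dim_at xs U A T u x e).
Proof.
by move=> e e' e0 ee'; apply: le_limn_einf => n;
  exact: complexity_ratio_antitone e0 ee'.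
Qed.

Lemma point_Dim_at_antitone xs U A x :
  antitone_pos (fun e => point_Dim_at xs U A T u x e).
Proof.
by move=> e e' e0 ee'; apply: le_limn_esup => n;
  exact: complexity_ratio_antitone e0 ee'.
Qed.

Lemma cover_cost_ge0 s e (F : set (X * nat)) :
  (0 <= \esum_(p in F) pow2e (- s%:E * bowen_sup T u p.2 p.1 e))%E.
Proof. by apply: esum_ge0 => *; exact: pow2e_ge0. Qed.

Lemma mBS_eq0P Z s e : mBS T u Z s e = 0%E <-> forall N (t : R), 0 < t ->
  exists2 F, bowen_covers T Z N e F &
    (\esum_(p in F) pow2e (- s%:E * bowen_sup T u p.2 p.1 e) <= t%:E)%E.
Proof.
have ge0 N : (0 <= mBS_at T u Z s N e)%E.
  by apply: le_ereal_inf_tmp => _ [F _ <-]; exact: cover_cost_ge0.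
split=> [m0 N t t0|h].
  have : (mBS_at T u Z s N e < t%:E)%E.
    apply: (@le_lt_trans _ _ 0%E); last by rewrite lte_fin.
    rewrite -m0 /mBS.
    have nd : {homo (fun N => mBS_at T u Z s N e) :
        n m / (n <= m)%N >-> (n <= m)%E}.
      move=> n m nm; apply: le_ereal_inf_tmp => _ [F [cF Fm ZF] <-].
      apply: ereal_inf_lbound; exists F => //; split=> // p /Fm.
      exact: leq_trans.
    rewrite (cvg_lim _ (ereal_nondecreasing_cvgn nd)) //.
    by apply: ereal_sup_ubound; exists N.
  by move=> /ereal_inf_lt[_ [F FZ <-] /ltW ?]; exists F.
rewrite /mBS (_ : (fun N => _) = cst 0%E) ?lim_cst //.
apply/funext => N; apply/eqP; rewrite eq_le ge0 andbT.
apply/lee_addgt0Pr => t t0; rewrite add0e; have [F FZ Ft] := h N t t0.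
by apply: le_trans Ft; apply: ereal_inf_lbound; exists F.
Qed.

Lemma dimBS_at_le Z e s : 0 <= s -> mBS T u Z s e = 0%E ->
  (dimBS_at T u Z e <= s%:E)%E.
Proof.
move=> s0 m0; rewrite /dimBS_at; apply: ereal_inf_lbound.
exists s; [split; [exact: s0|exact: m0]|exact: erefl].
Qed.

Lemma dimBS_at_lt Z e (l : \bar R) : (dimBS_at T u Z e < l)%E ->
  exists s, [/\ 0 <= s, (s%:E < l)%E & mBS T u Z s e = 0%E].
Proof. by move=> /ereal_inf_lt[_ [s [s0 m0] <-] sl]; exists s; split. Qed.

Lemma dimBS_at_antitone Z : antitone_pos (dimBS_at T u Z).
Proof.
move=> e e' e0 ee'; apply: le_ereal_inf_tmp => _ [s /= [s0 /mBS_eq0P m0] <-].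
apply: dimBS_at_le => //; apply/mBS_eq0P => N t t0.
have [F [cF FN ZF] Ft] := m0 N t t0; exists F.
  split=> // x /ZF[p Fp xp]; exists p => //; exact: sub_bowen_ball xp.
by apply: le_trans Ft; apply: le_esum => p _; apply: le_pow2eN => //;
  exact: le_bowen_sup.
Qed.

Lemma dimBSC_at_antitone Z : antitone_pos (dimBSC_at T u Z).
Proof.
move=> e e' e0 ee'; apply: le_ereal_inf_tmp => _ [s /= [s0 sZ] <-].
apply: ereal_inf_lbound; exists s; [split; [exact: s0|]|exact: erefl].
apply: le_lt_trans sZ; apply: le_limn_esup => n.
apply: le_ereal_inf_tmp => _ [G [cG ZG] <-].
apply: (@le_trans _ _ (\esum_(x in G) pow2e (- s%:E * bowen_sup T u n x e'))%E).
  apply: ereal_inf_lbound; exists G => //; split=> // x /ZG[y Gy xy].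
  by exists y => //; exact: sub_bowen_ball xy.
by apply: le_esum => y _; apply: le_pow2eN => //; exact: le_bowen_sup.
Qed.

Lemma DimBS_at_antitone Z : antitone_pos (DimBS_at T u Z).
Proof.
move=> e e' e0 ee'; apply: le_ereal_inf_tmp => _ [Zs ZZs <-].
apply: (@le_trans _ _ (ereal_sup (range (fun i => dimBSC_at T u (Zs i) e')))).
  by apply: ereal_inf_lbound; exists Zs.
apply: ge_ereal_sup => _ [i _ <-].
apply: (@le_trans _ _ (dimBSC_at T u (Zs i) e)); first exact: dimBSC_at_antitone.
by apply: ereal_sup_ubound; exists i.
Qed.

Lemma dimBSC_at_ge0 Z e : (0 <= dimBSC_at T u Z e)%E.
Proof. by apply: le_ereal_inf_tmp => _ [s [s0 _] <-]; rewrite lee_fin. Qed.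

Lemma dimBS_ge0 Z : (0 <= dimBS T u Z)%E.
Proof.
apply: le_trans (right_lim_ge (@dimBS_at_antitone Z) (ltr01 : 0 < 1 :> R)).
by apply: le_ereal_inf_tmp => _ [s [s0 _] <-]; rewrite lee_fin.
Qed.

Lemma DimBS_ge0 Z : (0 <= DimBS T u Z)%E.
Proof.
apply: le_trans (right_lim_ge (@DimBS_at_antitone Z) (ltr01 : 0 < 1 :> R)).
apply: le_ereal_inf_tmp => _ [Zs _ <-].
apply: le_trans (dimBSC_at_ge0 (Zs 0%N) 1) _.
by apply: ereal_sup_ubound; exists 0%N.
Qed.

End Dims.

(** * Sums over covers *)

Section Sums.
Context {R : realType} {I : choiceType}.
Implicit Types (a : I -> \bar R).

Lemma sub_esum a (F G : set I) : (forall i, 0 <= a i)%E -> F `<=` G ->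
  (\esum_(i in F) a i <= \esum_(i in G) a i)%E.
Proof.
move=> a0 FG; apply: ge_ereal_sup => _ [B [finB BF] <-].
by apply: esum_ge; exists B => //; split=> // i /BF /FG.
Qed.

Lemma esum_bigcup_le a (F : nat -> set I) (b : nat -> \bar R) :
  (forall i, 0 <= a i)%E -> (forall k, \esum_(i in F k) a i <= b k)%E ->
  (\esum_(i in \bigcup_k F k) a i <= \sum_(0 <= k <oo) b k)%E.
Proof.
move=> a0 Fb; rewrite seqDU_bigcup_eq nneseries_sum_bigcup;
  [|exact: trivIset_seqDU|exact: a0].
apply: lee_nneseries => [k _ _|k _]; first exact: esum_ge0.
by apply: le_trans (Fb k); apply: sub_esum => // i [].
Qed.

Lemma finite_le_esum a (F : set I) (s : seq I) : (forall i, 0 <= a i)%E ->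
  uniq s -> (forall i, i \in s -> F i) ->
  (\sum_(i <- s) a i <= \esum_(i in F) a i)%E.
Proof.
move=> a0 us sF; apply: esum_ge; exists [set` s].
  by split=> [|i /sF //]; exact: finite_seq.
by rewrite -fsbig_seq.
Qed.

Lemma esum_le_finite a (F : set I) (c : \bar R) :
  (forall s : seq I, uniq s -> (forall i, i \in s -> F i) ->
    \sum_(i <- s) a i <= c)%E -> (\esum_(i in F) a i <= c)%E.
Proof.
move=> h; apply: ge_ereal_sup => _ [B [finB BF] <-]; rewrite fsbig_finite //.
apply: h => // i; rewrite in_fset_set // => /set_mem; exact: BF.
Qed.

End Sums.

Lemma geometric_eseries (R : realType) (c q : R) : 0 <= c -> 0 < q -> q < 1 ->
  (\sum_(0 <= k <oo) (c * q ^+ k)%:E <= (c / (1 - q))%:E)%E.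
Proof.
move=> c0 q0 q1; have cv : cvgn (fun n => (\sum_(0 <= k < n) (c * q ^+ k)%:E)%E).
  apply: is_cvg_nneseries => k _ _.
  by rewrite lee_fin mulr_ge0 // exprn_ge0 // ltW.
apply: (lime_le cv).
apply: nearW => n; rewrite sumEFin lee_fin.
by apply: (geometric_le_lim n c0 q0); rewrite gtr0_norm.
Qed.

(** Covers taken at different times n can be united when their costs decay
    geometrically in n; both inequalities for the dimensions rely on this. *)
Lemma esum_slices (R : realType) (Y : choiceType) (w : Y * nat -> \bar R)
    (F : nat -> set Y) (N : nat) (c q : R) :
  (forall p, 0 <= w p)%E -> 0 <= c -> 0 < q -> q < 1 ->
  (forall n, (N <= n)%N -> \esum_(y in F n) w (y, n) <= (c * q ^+ n)%:E)%E ->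
  (\esum_(p in [set p | (N <= p.2)%N /\ F p.2 p.1]) w p <=
    (c * q ^+ N / (1 - q))%:E)%E.
Proof.
move=> w0 c0 q0 q1 Fw.
pose S k : set (Y * nat) := [set (y, (N + k)%N) | y in F (N + k)%N].
have -> : [set p | (N <= p.2)%N /\ F p.2 p.1] = \bigcup_k S k.
  apply/seteqP; split=> [[y n] /= [Nn Fy]|_ [k _ [y Fy <-]]] /=; last first.
    by rewrite leq_addr.
  by exists (n - N)%N => //; exists y; rewrite subnKC.
apply: (@le_trans _ _ (\sum_(0 <= k <oo) (c * q ^+ N * q ^+ k)%:E)%E).
  apply: esum_bigcup_le => // k; rewrite esum_image; last by move=> y z _ _ [].
  by rewrite -mulrA -exprD; apply: Fw; rewrite leq_addr.
by apply: geometric_eseries => //; rewrite mulr_ge0 // exprn_ge0 // ltW.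
Qed.

Lemma powR2_lt1 (R : realType) (a : R) : 0 < a -> 2 `^ (- a) < 1 :> R.
Proof. 
move=> a0; rewrite /powR gt_eqF // expR_lt1 mulNr oppr_lt0 mulr_gt0 //.
by rewrite ln_gt0 // ltr1n.
 Qed.

(** * Short descriptions give cheap covers *)

Section LowerBound.
Context {R : realType} {X : metricType R}.
Variables (T : X -> X) (u : X -> R) (xs : nat -> X) (U : oracle_code).
Hypothesis Uuniv : universal_prefix_free U.
Variable A : set nat.
Implicit Types (x y z : X) (n : nat) (e d s t : R) (Z : set X).

(** Dense points that a description of length at most s S_n u pays for, and at
    which the Birkhoff sum grows at rate at least [d]. *)
Definition short_centers s d n : set X := [set y | exists i, [/\ y = xs i,
  (complexity_nat U A i)%:R <= s * birkhoff_sum T u n y &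
  d * n%:R <= birkhoff_sum T u n y]].

Lemma countable_short_centers s d n : countable (short_centers s d n).
Proof.
apply: (@sub_countable _ _ _ (range xs)).
  by apply: subset_card_le => _ [i [-> _ _]]; exists i.
by apply: card_image_le.
Qed.

(** The cost of a centre splits into 2^(-s S_n u) <= 2^-K and
    2^(-t S_n u) <= 2^(-t d n); the first factors are summed by Kraft's
    inequality. *)
Lemma short_centers_cost s t d e n : 0 <= s -> 0 <= t -> 0 < e ->
  (\esum_(y in short_centers s d n)
    pow2e (- (s + t)%:E * bowen_sup T u n y e) <= (2 `^ (- (t * d)) ^+ n)%:E)%E.
Proof.
move=> s0 t0 e0; apply: esum_le_finite => c uc cG.
have /choice[i iP] : forall y, exists i, y \in c -> [/\ y = xs i,
    (complexity_nat U A i)%:R <= s * birkhoff_sum T u n y &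
    d * n%:R <= birkhoff_sum T u n y].
  move=> y; case: (boolP (y \in c)) => [/cG[i ?]|_]; last by exists 0%N.
  by exists i.
set q := 2 `^ (- (t * d)).
apply: (@le_trans _ _
    (\sum_(y <- c) (2^-1 ^+ complexity_nat U A (i y) * q ^+ n)%:E)%E).
  rewrite big_seq [leRHS]big_seq; apply: lee_sum => y yc.
  have [_ yK yd] := iP y yc.
  apply: (@le_trans _ _ (pow2e (- (s + t)%:E * (birkhoff_sum T u n y)%:E))).
    by apply: le_pow2eN (bowen_sup_ge _ _ _ _ e0); rewrite addr_ge0.
  rewrite -EFinN -EFinM /= lee_fin.
  have -> : 2^-1 ^+ complexity_nat U A (i y) * q ^+ n =
      2 `^ (- (complexity_nat U A (i y))%:R - t * d * n%:R).
    have -> : - (complexity_nat U A (i y))%:R - t * d * n%:R =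
        - (complexity_nat U A (i y))%:R + - (t * d) * n%:R :> R by ring.
    rewrite powRD ?pnatr_eq0 ?implybT // powRrM -/q powR_mulrn ?powR_ge0 //.
    by rewrite powRN powR_mulrn // exprVn.
  apply: ler_powR; first by rewrite ler1n.
  have : t * (d * n%:R) <= t * birkhoff_sum T u n y by rewrite ler_wpM2l.
  by rewrite mulrA => ?; rewrite mulNr mulrDl opprD lerB // lerNr opprK.
rewrite sumEFin lee_fin -mulr_suml -[leRHS]mul1r ler_wpM2r //.
  by rewrite exprn_ge0 // powR_ge0.
rewrite -(big_map i predT (fun j => 2^-1 ^+ complexity_nat U A j)).
apply: complexity_kraft => //; rewrite map_inj_in_uniq // => y z yc zc iyz.
by have [-> _ _] := iP y yc; have [-> _ _] := iP z zc; rewrite iyz.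
Qed.

(** The rate drops from 2 d to d because the Birkhoff sums of two points of the
    Bowen ball may differ by d n. *)
Lemma ratio_short_center s d e n x : 0 < d -> (0 < n)%N -> modulus u e d ->
  d *+ 2 * n%:R <= birkhoff_sum T u n x ->
  (complexity_ratio xs U A T u x e n < s%:E)%E ->
  exists2 y, short_centers s d n y & bowen_ball T n y e x.
Proof.
move=> d0 n0 md dx /ereal_inf_lt[_ [i /= xi <-]]; rewrite lte_fin => Ki.
have := birkhoff_sum_near md xi; rewrite -mulr_natr.
have dn : 0 < d * n%:R by rewrite mulr_gt0 // ltr0n.
move: dx; rewrite mulr2n mulrDl => dx near.
have di : d * n%:R <= birkhoff_sum T u n (xs i) by lra.
exists (xs i); last exact: bowen_ball_sym.
by exists i; split=> //; rewrite -ler_pdivrMr ?ltW // (lt_le_trans dn).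
Qed.

Lemma lower_average_gt x : (0 < lower_average T u x)%E ->
  exists2 c : R, 0 < c &
    exists N, forall n, (N <= n)%N -> c * n%:R <= birkhoff_sum T u n x.
Proof.
move=> l0; have [c c0 cl] : exists2 c : R, 0 < c & (c%:E < lower_average T u x)%E.
  case: (lower_average T u x) l0 => [r| |] //; last by exists 1; rewrite ?ltry.
  by rewrite lte_fin => r0; exists (r / 2); rewrite ?lte_fin; lra.
exists c => //; have [N hN] := lt_limn_einf cl; exists N.+1 => n Nn.
have n0 : 0 < n%:R :> R by rewrite ltr0n; case: n Nn.
by rewrite -ler_pdivlMr // ltW // -lte_fin; apply: hN; exact: ltnW.
Qed.

(** Pieces of [Z] on which the linear growth of the Birkhoff sums is uniform. *)
Definition fast_points Z m N : set X := [set x | Z x /\ forall n, (N <= n)%N ->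
  mesh m *+ 2 * n%:R <= birkhoff_sum T u n x].

Lemma sub_fast_points Z x : Z x -> (0 < lower_average T u x)%E ->
  exists m N, fast_points Z m N x.
Proof.
move=> Zx /lower_average_gt[c c0 [N cN]].
have [m /(_ m (leqnn m)) mc] := mesh_small c0.
exists m, N; split=> // n /cN; apply: le_trans.
by rewrite ler_wpM2r // mulr2n.
Qed.

Lemma small_modulus d e : unif_continuous u -> 0 < d -> 0 < e ->
  exists e', [/\ 0 < e', e' <= e & modulus u e' d].
Proof.
move=> ucont d0 e0; have [e' e'0 me'] := modulus_exists ucont d0.
exists (Num.min e e'); rewrite lt_min e0 e'0 ge_min lexx; split=> // x y.
by rewrite lt_min => /andP[_]; exact: me'.
Qed.

(** For each rate 1/(m+1), the short centres at all times from [M m] on, with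
    [M m] so large that their total cost is at most th / 2^(m+1).  The radius e' is
    chosen according to the rate, but the costs are taken at the given e: the
    bound of the cost does not depend on the radius. *)
Lemma mBS_short_descriptions Z s t e : unif_continuous u ->
  (forall x, Z x -> (0 < lower_average T u x)%E) ->
  0 <= s -> 0 < t -> 0 < e ->
  (forall x e', Z x -> 0 < e' -> (point_dim_at xs U A T u x e' < s%:E)%E) ->
  mBS T u Z (s + t) e = 0%E.
Proof.
move=> ucont Zpos s0 t0 e0 Zs; apply/mBS_eq0P => N th th0.
pose d m : R := mesh m.
have d0 m : 0 < d m by exact: mesh_gt0.
pose q m : R := 2 `^ (- (t * d m)).
have q0 m : 0 < q m by exact: powR_gt0.
have q1 m : q m < 1 by apply: powR2_lt1; rewrite mulr_gt0.
have /choice[M MP] : forall m, exists M, (N <= M)%N /\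
    q m ^+ M / (1 - q m) <= th / (2 ^ m.+1)%:R.
  move=> m; have b0 : 0 < th / (2 ^ m.+1)%:R * (1 - q m).
    by rewrite mulr_gt0 ?subr_gt0 // divr_gt0 // ltr0n expn_gt0.
  have qn : `|q m| < 1 by rewrite gtr0_norm.
  have /cvgr0Pnorm_lt /(_ _ b0) [k _ kP] := cvg_geometric 1 qn.
  (* Powers of q tend to 0, and the series from M on is q^M / (1 - q). *)
  exists (maxn N k); rewrite leq_maxl; split=> //.
  rewrite ler_pdivrMr ?subr_gt0 // ltW //.
  have := kP (maxn N k) (leq_maxr _ _); apply: le_lt_trans.
  by rewrite /geometric /= mul1r ler_norm.
(* Time 0 is excluded: the Birkhoff sum vanishes there. *)
pose F m : set (X * nat) :=
  [set p | (maxn 1 (M m) <= p.2)%N /\ short_centers s (d m) p.2 p.1].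
exists (\bigcup_m F m).
  split.
  - apply: bigcup_countable => // m _.
    apply: (@sub_countable _ _ _ (range (fun p : nat * nat => (xs p.1, p.2)))).
      apply: subset_card_le => -[_ n] [_ [i [/= -> _ _]]].
      by exists (i, n).
    exact: sub_countable (card_image_le _ _) (countableP _).
  - move=> p [m _ [Mp _]]; apply: leq_trans (MP m).1 _.
    by move: Mp; rewrite geq_max => /andP[].
  - move=> x Zx; have [m [N' [_ fast]]] := sub_fast_points Zx (Zpos x Zx).
    have [e' [e'0 e'e me']] := small_modulus ucont (d0 m) e0.
    have [n] := limn_einf_lt (Zs x e' Zx e'0) (maxn N' (maxn 1 (M m))).
    rewrite geq_max => /andP[N'n Mn] xn.
    have n0 : (0 < n)%N by apply: leq_trans Mn; rewrite leq_max.
    have [y yc yx] := ratio_short_center (d0 m) n0 me' (fast n N'n) xn.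
    exists (y, n); last exact: sub_bowen_ball yx.
    by exists m => //; split.
apply: (@le_trans _ _ (\sum_(0 <= m <oo) (th / (2 ^ m.+1)%:R)%:E)%E); last first.
  exact: (epsilon_trick0 xpredT (ltW th0)).
apply: esum_bigcup_le => [p|m]; first exact: pow2e_ge0.
apply: (@le_trans _ _ (1 * q m ^+ maxn 1 (M m) / (1 - q m))%:E).
  apply: (esum_slices (F := fun n => short_centers s (d m) n)) => //.
    by move=> p; exact: pow2e_ge0.
  move=> n _; rewrite mul1r.
  by apply: short_centers_cost => //; exact: ltW.
rewrite mul1r lee_fin; apply: le_trans (MP m).2; rewrite ler_wpM2r //.
  by rewrite invr_ge0 subr_ge0 ltW.
by apply: ler_wiXn2l; rewrite ?leq_maxr // ltW.
Qed.

(** On the part of [fast_points Z m N] where the ratio is below s from time N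
    on, the short centres at the single time n form a cover, of cost at most 1:
    no sum over n occurs and no exponent is lost. *)
Lemma DimBS_short_descriptions Z s e : unif_continuous u ->
  (forall x, Z x -> (0 < lower_average T u x)%E) ->
  0 <= s -> 0 < e ->
  (forall x e', Z x -> 0 < e' -> (point_Dim_at xs U A T u x e' < s%:E)%E) ->
  (DimBS_at T u Z e <= s%:E)%E.
Proof.
move=> ucont Zpos s0 e0 Zs.
pose d m : R := mesh m.
have d0 m : 0 < d m by exact: mesh_gt0.
have /choice[eps epsP] m := small_modulus ucont (d0 m) e0.
pose Zk k := let: (m, N) := Cantor.of_nat k in [set x | fast_points Z m N x /\
  forall n, (N <= n)%N -> (complexity_ratio xs U A T u x (eps m) n < s%:E)%E].
apply: (@le_trans _ _ (ereal_sup (range (fun k => dimBSC_at T u (Zk k) e)))).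
  apply: ereal_inf_lbound; exists Zk => // x Zx.
  have [m [N1 [_ fast]]] := sub_fast_points Zx (Zpos x Zx).
  have [e'0 _ _] := epsP m.
  have [N2 short] := limn_esup_lt (Zs x _ Zx e'0).
  exists (Cantor.to_nat (m, maxn N1 N2)) => //=.
  rewrite /Zk Cantor.cancel_of_to; split; [split=> //|] => n;
    rewrite geq_max => /andP[N1n N2n]; [exact: fast|exact: short].
apply: ge_ereal_sup => _ [k _ <-]; rewrite /Zk.
case: (Cantor.of_nat k) => m N; have [e'0 e'e me'] := epsP m.
apply: ereal_inf_lbound; exists s; [split; [exact: s0|]|exact: erefl].
apply: (@le_lt_trans _ _ 1%E); last exact: ltry.
apply: (@limn_esup_le _ _ _ (maxn 1 N)) => n; rewrite geq_max => /andP[n0 Nn].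
apply: (@le_trans _ _ (\esum_(y in short_centers s (d m) n)
    pow2e (- (s + 0)%:E * bowen_sup T u n y e))%E).
  apply: ereal_inf_lbound; exists (short_centers s (d m) n); last by rewrite addr0.
  split; first exact: countable_short_centers.
  move=> x [[_ fast] short].
  have [y yc yx] := ratio_short_center (d0 m) n0 me' (fast n Nn) (short n Nn).
  by exists y => //; exact: sub_bowen_ball yx.
apply: le_trans (short_centers_cost _ _ s0 (lexx 0) e0) _.
by rewrite mul0r oppr0 powRr0 expr1n.
Qed.

Lemma nneg_sup_ge Z (f : X -> \bar R) x : Z x -> (f x <= nneg_sup Z f)%E.
Proof. by move=> Zx; apply: ereal_sup_ubound; right; exists x. Qed.

Lemma nneg_sup_ge0 Z (f : X -> \bar R) : (0 <= nneg_sup Z f)%E.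
Proof. by apply: ereal_sup_ubound; left. Qed.

Lemma dimBS_le_point_dim Z : unif_continuous u ->
  (forall x, Z x -> (0 < lower_average T u x)%E) ->
  (dimBS T u Z <= nneg_sup Z (fun x => point_dim xs U A T u x))%E.
Proof.
move=> ucont Zpos; apply: le_of_real_gt => [|s t ls t0].
  exact: nneg_sup_ge0.
have s0 : 0 <= s.
  by rewrite -lee_fin; apply: le_trans (ltW ls); exact: nneg_sup_ge0.
apply: right_lim_le => [|e e0]; first exact: dimBS_at_antitone.
exists e; split=> //; apply: dimBS_at_le; first by rewrite addr_ge0 // ltW.
apply: mBS_short_descriptions => // x e' Zx e'0.
apply: le_lt_trans ls; apply: le_trans (nneg_sup_ge _ Zx).
apply: right_lim_ge e'0; exact: point_dim_at_antitone.
Qed.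

Lemma DimBS_le_point_Dim Z : unif_continuous u ->
  (forall x, Z x -> (0 < lower_average T u x)%E) ->
  (DimBS T u Z <= nneg_sup Z (fun x => point_Dim xs U A T u x))%E.
Proof.
move=> ucont Zpos; apply: le_of_real_gt => [|s t ls t0].
  exact: nneg_sup_ge0.
have s0 : 0 <= s.
  by rewrite -lee_fin; apply: le_trans (ltW ls); exact: nneg_sup_ge0.
apply: right_lim_le => [|e e0]; first exact: DimBS_at_antitone.
exists e; split=> //; apply: (@le_trans _ _ s%:E); last first.
  by rewrite lee_fin lerDl ltW.
apply: DimBS_short_descriptions => // x e' Zx e'0.
apply: le_lt_trans ls; apply: le_trans (nneg_sup_ge _ Zx).
apply: right_lim_ge e'0; exact: point_Dim_at_antitone.
Qed.

End LowerBound.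

(** * Upper bounds of the complexity along covers *)

(** Chebyshev's counting: at most 2^L elements have weight at least 2^-L.  A
    real length l is rounded up to the next integer. *)
Lemma weighted_oracle (R : realType) (I : choiceType) U (J : set I)
    (w : I -> \bar R) (code : I -> nat) :
  universal_prefix_free U -> (forall j, 0 <= w j)%E ->
  (\esum_(j in J) w j <= 1)%E ->
  exists A, forall eta : R, 0 < eta -> exists c : R, forall j l, J j -> 0 <= l ->
    ((2 `^ (- l))%:E <= w j)%E ->
    (complexity_nat U A (code j))%:R <= (1 + eta) * l + c.
Proof.
move=> Uuniv w0 w1.
pose V L : set nat :=
  [set i | exists j, [/\ J j, ((2^-1 ^+ L)%:E <= w j)%E & code j = i]].
have V2 L : at_most (2 ^ L) (V L).
  move=> s us sV; have [s0|[i0 i0s]] : s = [::] \/ exists i, i \in s.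
    by case: s {us sV} => [|i s]; [left|right; exists i; rewrite mem_head].
    by rewrite s0.
  have [j0 _] : exists j, J j.
    by have [j [Jj _ _]] := sV _ i0s; exists j.
  have /choice[j jP] : forall i, exists j, i \in s ->
      [/\ J j, ((2^-1 ^+ L)%:E <= w j)%E & code j = i].
    by move=> i; case: (boolP (i \in s)) => [/sV[j ?]|_]; [exists j|exists j0].
  have : ((\sum_(i <- s) 2^-1 ^+ L)%:E <= 1 :> \bar R)%E.
    apply: le_trans w1; rewrite -sumEFin.
    apply: (@le_trans _ _ (\sum_(i <- map j s) w i)%E).
      rewrite big_map [leLHS]big_seq [leRHS]big_seq; apply: lee_sum => i /jP.
      by case.
    apply: finite_le_esum => //; last by move=> _ /mapP[i /jP[? _ _] ->].
    rewrite map_inj_in_uniq // => i i' /jP[_ _ {2}<-] /jP[_ _ {2}<-].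
    by move=> ->.
  rewrite lee_fin big_const_seq count_predT iter_addr_0.
  rewrite -[_ *+ size s]mulr_natl exprVn.
  by rewrite ler_pdivrMr ?exprn_gt0 // mul1r -natrX ler_nat.
have [A AP] := counting_oracle R Uuniv V2.
exists A => eta eta0; have [c cP] := AP eta eta0.
exists (1 + eta + c) => j l Jj l0 lw.
have lL : l < (Num.trunc l).+1%:R by exact: truncnS_gt.
have Ll : (Num.trunc l)%:R <= l by rewrite truncn_le.
have /cP : V (Num.trunc l).+1 (code j).
  exists j; split=> //; apply: le_trans lw; rewrite lee_fin exprVn.
  rewrite -powR_mulrn // -powRN; apply: ler_powR; first by rewrite ler1n.
  by rewrite lerN2 ltW.
move=> /le_trans; apply; rewrite -[_.+1%:R]natr1.
have : (1 + eta) * (Num.trunc l)%:R <= (1 + eta) * l.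
  by rewrite ler_wpM2l // addr_ge0 // ltW.
by rewrite mulrDr mulr1; lra.
Qed.

(** The arithmetic behind the upper bound, with S standing for a Birkhoff sum
    that grows at rate c / 2.  Since n <= (2 / c) S and C <= kappa n for large n,
    all errors are at most kappa S times the constant [B] below. *)
Lemma overhead (R : realType) (D c tau : R) : 0 <= D -> 0 < c -> 0 < tau ->
  exists kappa : R, [/\ 0 < kappa, kappa <= c / 2 &
    forall C : R, exists n1, forall n (s th S : R), (n1 <= n)%N ->
      0 <= s <= D + kappa -> 0 <= th <= kappa -> c / 2 * n%:R <= S ->
      0 < S /\
      (1 + kappa) * (s * (S + kappa * n%:R) + (th * n%:R + C)) + C <=
        (D + tau) * S].
Proof.
move=> D0 c0 tau0; pose b := 2 / c.
have b0 : 0 < b by rewrite divr_gt0.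
pose B := 1 + (1 + 2 * b) * (D + 1) + 5 * b.
have B0 : 0 < B.
  have bD : 0 <= (1 + 2 * b) * (D + 1) by apply: mulr_ge0; lra.
  by rewrite /B; lra.
pose k := Num.min 1 (Num.min (c / 2) (tau / B)).
have k1 : k <= 1 by rewrite /k ge_min lexx.
have kc : k <= c / 2 by rewrite /k !ge_min lexx orbT.
have kB : k * B <= tau by rewrite -ler_pdivlMr // /k !ge_min lexx !orbT.
have k0 : 0 < k by rewrite /k !lt_min ltr01 !divr_gt0.
exists k; split=> // C.
have := archi_boundP (divr_ge0 (normr_ge0 C) (ltW k0)).
set n1 := Num.bound _ => Cn1.
exists n1.+1 => n s th S n1n /andP[s0 sD] /andP[th0 thk] nS.
have n0 : 0 < n%:R :> R by rewrite ltr0n (leq_trans _ n1n).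
have S0 : 0 < S by apply: lt_le_trans nS; rewrite mulr_gt0 // divr_gt0.
split=> //.
have nbS : n%:R <= b * S.
  have -> : n%:R = b * (c / 2 * n%:R) by rewrite /b; field; rewrite gt_eqF.
  by rewrite ler_wpM2l // ltW.
have Cb : C <= k * b * S.
  rewrite (le_trans (ler_norm C)) // -mulrA mulrC -ler_pdivrMr //.
  rewrite (le_trans (ltW Cn1)) // (le_trans _ nbS) // ler_nat.
  exact: ltnW.
have kn : k * n%:R <= k * b * S by rewrite -mulrA ler_wpM2l // ltW.
have tn : th * n%:R <= k * b * S by apply: le_trans kn; rewrite ler_wpM2r // ltW.
have X0 : 0 <= k * b * S by rewrite ltW // (mulr_gt0 (mulr_gt0 k0 b0)).
have sS : s * (S + k * n%:R) <= (D + k) * (S + k * b * S).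
  apply: ler_pM => //; last by rewrite lerD2l.
  by rewrite ltW // addr_gt0 // mulr_gt0.
apply: (@le_trans _ _ ((1 + k) * ((D + k) * (S + k * b * S) +
    (k * b * S + k * b * S)) + k * b * S)).
  apply: lerD => //; apply: ler_wpM2l; first by rewrite addr_ge0 // ltW.
  by do 2 apply: lerD => //.
have -> : (1 + k) * ((D + k) * (S + k * b * S) + (k * b * S + k * b * S)) +
    k * b * S =
    ((1 + k) * (D + k) * (1 + k * b) + (1 + k) * (2 * k * b) + k * b) * S.
  by ring.
apply: ler_wpM2r; first exact: ltW.
apply: (@le_trans _ _ (D + k * B)); last first.
  by rewrite lerD2l.
have kk : k * k <= k by rewrite -[leRHS]mulr1 ler_wpM2l // ltW.
have kkb : k * k * b <= k * b by rewrite ler_wpM2r // ltW.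
have : (1 + k) * (1 + k * b) <= 1 + k * (1 + 2 * b).
  by lra.
move=> /(ler_wpM2l (addr_ge0 D0 (ltW k0))).
have : k * (k * (1 + 2 * b)) <= k * (1 + 2 * b).
  by rewrite mulrA ler_wpM2r // addr_ge0 // mulr_ge0 // ltW.
rewrite /B; lra.
Qed.

Section UpperBound.
Context {R : realType} {X : metricType R}.
Variables (T : X -> X) (u : X -> R) (xs : nat -> X) (U : oracle_code).
Hypotheses (Tcont : continuous T) (ucont : unif_continuous u).
Hypotheses (xs_dense : dense (range xs)) (Uuniv : universal_prefix_free U).
Implicit Types (x y z : X) (n k r : nat) (Z : set X).

(** One oracle for countably many families [F r], each with its scale and its
    exponent [s r].  The weight of (y, n) in family r has the exponent
    s u(y, n, e) + n / (k + 1) + C r: the constant allows a normalisation of the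
    family and is absorbed as n grows, and the term n / (k + 1) pays for
    summation over n.  A point within the Bowen ball of (y, n) is within twice
    the radius of the dense point that stands for y. *)
Lemma covers_oracle (D : R) (F : nat -> set (X * nat)) (scale : nat -> nat)
    (s C : nat -> R) : 0 <= D ->
  (forall r, 0 <= s r <= D + mesh (scale r)) -> (forall r, 0 <= C r) ->
  (forall r, \esum_(p in F r) (2 `^ (- (mesh (scale r) * p.2%:R + C r)))%:E *
      pow2e (- (s r)%:E * bowen_sup T u p.2 p.1 (mesh (scale r)))
    <= (1 / (2 ^ r.+1)%:R)%:E)%E ->
  exists A, forall x tau, (0 < lower_average T u x)%E -> 0 < tau ->
  exists k0, forall C0, exists n1, forall r n y, (k0 <= scale r)%N ->
    C r <= C0 -> (n1 <= n)%N -> F r (y, n) ->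
    bowen_ball T n y (mesh (scale r)) x ->
    (complexity_ratio xs U A T u x (mesh (scale r) + mesh (scale r)) n <=
      (D + tau)%:E)%E.
Proof.
move=> D0 sD C0 Fcost.
pose w (j : nat * (X * nat)) : \bar R :=
  ((2 `^ (- (mesh (scale j.1) * j.2.2%:R + C j.1)))%:E *
   pow2e (- (s j.1)%:E * bowen_sup T u j.2.2 j.2.1 (mesh (scale j.1))))%E.
have w0 j : (0 <= w j)%E by rewrite mule_ge0 ?pow2e_ge0 // lee_fin powR_ge0.
pose J : set (nat * (X * nat)) := [set j | F j.1 j.2].
have J1 : (\esum_(j in J) w j <= 1)%E.
  have -> : J = \bigcup_r [set (r, p) | p in F r].
    apply/seteqP; split=> [[r p] Fp|_ [r _ [p Fp <-]]] //.
    by exists r => //; exists p.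
  apply: le_trans (epsilon_trick0 xpredT ler01).
  apply: esum_bigcup_le => // r; rewrite esum_image; first exact: Fcost.
  by move=> p p' _ _ [].
have /choice[code codeP] : forall j : nat * (X * nat), exists i,
    bowen_ball T j.2.2 j.2.1 (mesh (scale j.1)) (xs i).
  by move=> j; apply: dense_bowen_ball => //; exact: mesh_gt0.
have [A AP] := weighted_oracle code Uuniv w0 J1.
exists A => x tau /lower_average_gt[c c0 [N0 fast]] tau0.
have [kap [kap0 kapc kapP]] := overhead D0 c0 tau0.
have [e e0 me] := modulus_exists ucont kap0.
have [c1 c1P] := AP kap kap0.
have [k1 k1P] := mesh_small e0; have [k2 k2P] := mesh_small kap0.
exists (maxn k1 k2) => Cmax; have [n1 n1P] := kapP (Num.max Cmax c1).
exists (maxn N0 n1) => r n y; rewrite !geq_max => /andP[k1r k2r] CrC.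
move=> /andP[N0n n1n] Fyn yx; set m := mesh (scale r).
have m0 : 0 < m :> R by exact: mesh_gt0.
have mkap : m <= kap by have := k2P _ k2r; rewrite -/m; lra.
have mem : modulus u (m + m) kap.
  by move=> z z' zz'; apply: me; apply: lt_le_trans zz' (k1P _ k1r).
set i := code (r, (y, n)); have yi := codeP (r, (y, n)); rewrite /= -/i -/m in yi.
have xi : bowen_ball T n x (m + m) (xs i).
  exact: bowen_ball_triangle (bowen_ball_sym yx) yi.
set S := birkhoff_sum T u n (xs i).
have cS : c / 2 * n%:R <= S.
  have := birkhoff_sum_near mem xi; rewrite -/S -[kap *+ n]mulr_natr => near.
  have := fast n N0n => fastn.
  have : kap * n%:R <= c / 2 * n%:R by rewrite ler_wpM2r.
  lra.
have sr : 0 <= s r <= D + kap.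
  by have /andP[-> srD] := sD r; apply: le_trans srD _; rewrite lerD2l.
have m0kap : 0 <= m <= kap by rewrite ltW.
have [S0 SP] := n1P n (s r) m S n1n sr m0kap cS.
have s0 : 0 <= s r by case/andP: sr.
have nn0 : 0 <= n%:R :> R by [].
pose l := s r * (S + kap * n%:R) + (m * n%:R + C r).
have l0 : 0 <= l.
  by rewrite /l !addr_ge0 // !mulr_ge0 // ?addr_ge0 ?mulr_ge0 // ltW.
have lw : ((2 `^ (- l))%:E <= w (r, (y, n)))%E.
  have -> : - l = - (m * n%:R + C r) + - (s r * (S + kap * n%:R)).
    by rewrite /l; ring.
  rewrite /w /= -/m powRD ?pnatr_eq0 ?implybT // EFinM.
  apply: lee_wpmul2l; first by rewrite lee_fin powR_ge0.
  have := bowen_sup_le mem yi; rewrite -/S -[kap *+ n]mulr_natr => /(le_pow2eN s0).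
  by rewrite -EFinN -EFinM /= mulNr.
have Kl := c1P (r, (y, n)) l Fyn l0 lw; rewrite -/i in Kl.
apply: (@le_trans _ _ ((complexity_nat U A i)%:R / S)%:E).
  by apply: ereal_inf_lbound; exists i.
rewrite lee_fin ler_pdivrMr //; apply: le_trans Kl _; apply: le_trans SP.
apply: lerD; last by rewrite le_max lexx orbT.
apply: ler_wpM2l; first by rewrite addr_ge0 // ltW.
by rewrite /l !lerD2l (le_trans CrC) // le_max lexx.
Qed.

End UpperBound.

(** * Optimal oracles *)

Section OptimalOracle.
Context {R : realType} {X : metricType R}.
Variables (T : X -> X) (u : X -> R) (xs : nat -> X) (U : oracle_code).
Hypotheses (Tcont : continuous T) (ucont : unif_continuous u).
Hypotheses (xs_dense : dense (range xs)) (Uuniv : universal_prefix_free U).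
Variable Z : set X.
Hypothesis Zpos : forall x, Z x -> (0 < lower_average T u x)%E.
Implicit Types (x y z : X) (n k r : nat).

Lemma nneg_sup_le (f : X -> \bar R) (l : \bar R) : (0 <= l)%E ->
  (forall x, Z x -> (f x <= l)%E) -> (nneg_sup Z f <= l)%E.
Proof. by move=> l0 fl; apply: ge_ereal_sup => _ [->|[x Zx <-]] //; exact: fl. Qed.

(** The families are indexed by pairs (k, N): a cover at scale 1/(k+1) by balls
    of order at least N.  Letting N grow gives infinitely many good times. *)
Lemma point_dim_le_dimBS :
  exists A, (nneg_sup Z (fun x => point_dim xs U A T u x) <= dimBS T u Z)%E.
Proof.
have := dimBS_ge0 T u Z; case Ddim : (dimBS T u Z) => [D| |] // D0; last first.
  by exists set0; exact: leey.
rewrite lee_fin in D0.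
have /choice[s sP] : forall k, exists s, [/\ 0 <= s, s <= D + mesh k &
    mBS T u Z s (mesh k) = 0%E].
  move=> k; have m0 := @mesh_gt0 R k.
  have : (dimBS_at T u Z (mesh k) < (D + mesh k)%:E)%E.
    apply: (@le_lt_trans _ _ (dimBS T u Z)); last by rewrite Ddim lte_fin ltrDl.
    exact: right_lim_ge (@dimBS_at_antitone _ _ T u Z) m0.
  by move=> /dimBS_at_lt[s [s0 sD ms]]; exists s; split; [|exact: ltW|].
pose scale r := (Cantor.of_nat r).1.
have /choice[F FP] : forall r, exists F,
    bowen_covers T Z (Cantor.of_nat r).2 (mesh (scale r)) F /\
    (\esum_(p in F) pow2e (- (s (scale r))%:E *
       bowen_sup T u p.2 p.1 (mesh (scale r))) <= (1 / (2 ^ r.+1)%:R)%:E)%E.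
  move=> r; have [_ _ /mBS_eq0P m0] := sP (scale r).
  have [|F] := m0 (Cantor.of_nat r).2 (1 / (2 ^ r.+1)%:R).
    by rewrite divr_gt0 // ltr0n expn_gt0.
  by exists F.
have [||r|A AP] := @covers_oracle R X T u xs U Tcont ucont xs_dense Uuniv
    D F scale (s \o scale) (fun=> 0) D0.
- by move=> r; have [s0 sD _] := sP (scale r); apply/andP.
- by [].
- apply: le_trans (FP r).2; apply: le_esum => p _ /=.
  rewrite -[leRHS]mul1e; apply: lee_wpmul2r; first exact: pow2e_ge0.
  rewrite lee_fin -[leRHS](powRr0 (2 : R)) addr0; apply: ler_powR.
    by rewrite ler1n.
  by rewrite oppr_le0 mulr_ge0 // ltW // mesh_gt0.
exists A; apply: nneg_sup_le => [|x Zx]; first by rewrite lee_fin.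
apply/lee_addgt0Pr => tau tau0; rewrite -EFinD.
have [k0 k0P] := AP x tau (Zpos Zx) tau0.
have [n1 n1P] := k0P 0.
apply: right_lim_le => [|e e0]; first exact: point_dim_at_antitone.
have [k1 k1P] := mesh_small e0; pose k := maxn k0 k1.
exists (mesh k + mesh k); split.
- by rewrite addr_gt0 // mesh_gt0.
- by apply: k1P; rewrite leq_maxr.
- apply: limn_einf_le => N; pose r := Cantor.to_nat (k, maxn N n1).
  have [[_ FN /(_ x Zx)[[y n] Fyn yx]] _] := FP r.
  have rk : scale r = k by rewrite /scale Cantor.cancel_of_to.
  have := FN _ Fyn; rewrite Cantor.cancel_of_to /= geq_max => /andP[Nn n1n].
  exists n => //; rewrite -rk; apply: (n1P r n y) => //.
  by rewrite rk leq_maxl.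
Qed.

Lemma DimBS_cover (e D : R) : (DimBS_at T u Z e < D%:E)%E ->
  exists Zs : nat -> set X, Z `<=` \bigcup_i Zs i /\
    forall i, exists s, [/\ 0 <= s, s <= D &
      exists C N, forall n, (N <= n)%N -> (capBS_at T u (Zs i) s n e < C%:E)%E].
Proof.
move=> /ereal_inf_lt[_ [Zs ZZs <-] ZsD]; exists Zs; split=> // i.
have : (dimBSC_at T u (Zs i) e < D%:E)%E.
  by apply: le_lt_trans ZsD; apply: ereal_sup_ubound; exists i.
move=> /ereal_inf_lt[_ [s [s0 sfin] <-] sD].
exists s; split; [exact: s0|by rewrite -lee_fin ltW|].
have [C sC] : exists C : R,
    (limn_esup (fun n => capBS_at T u (Zs i) s n e) < C%:E)%E.
  move: (limn_esup _) sfin => l; case: l => [l _|//|_].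
  - by exists (l + 1); rewrite lte_fin ltrDl.
  - by exists 0; rewrite ltNyr.
by exists C; have [N hN] := limn_esup_lt sC; exists N.
Qed.

Lemma powR2_small (b : R) : 0 < b -> exists2 c : R, 0 <= c & 2 `^ (- c) <= b.
Proof.
move=> b0; have [k] := ltr_add_invr b0; rewrite add0r => kb.
exists k.+1%:R => //; rewrite powRN powR_mulrn //; apply: le_trans (ltW kb).
rewrite lef_pV2 ?posrE ?exprn_gt0 ?ltr0n // -natrX ler_nat ltnW //.
exact: ltn_expl.
Qed.

(** The families are indexed by pairs (k, i), where i numbers the pieces of a
    decomposition at scale 1/(k+1).  Family (k, i) collects covers of its piece
    for every large n, so each n is a good time.  The covers have bounded cost,
    the weights 2^(-n/(k+1)) make the sum over n geometric, and the constant c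
    normalises it. *)
Lemma point_Dim_le_DimBS :
  exists A, (nneg_sup Z (fun x => point_Dim xs U A T u x) <= DimBS T u Z)%E.
Proof.
have := DimBS_ge0 T u Z; case Ddim : (DimBS T u Z) => [D| |] // D0; last first.
  by exists set0; exact: leey.
rewrite lee_fin in D0.
have /choice[Zs ZsP] : forall k, exists Zs : nat -> set X,
    Z `<=` \bigcup_i Zs i /\ forall i, exists s, [/\ 0 <= s, s <= D + mesh k &
    exists C N, forall n, (N <= n)%N ->
      (capBS_at T u (Zs i) s n (mesh k) < C%:E)%E].
  move=> k; have m0 := @mesh_gt0 R k; apply: DimBS_cover.
  apply: (@le_lt_trans _ _ (DimBS T u Z)); last by rewrite Ddim lte_fin ltrDl.
  exact: right_lim_ge (@DimBS_at_antitone _ _ T u Z) m0.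
pose scale r := (Cantor.of_nat r).1.
pose part r := Zs (scale r) (Cantor.of_nat r).2.
have /choice[s sP] : forall r, exists s, [/\ 0 <= s, s <= D + mesh (scale r) &
    exists C N, forall n, (N <= n)%N ->
      (capBS_at T u (part r) s n (mesh (scale r)) < C%:E)%E].
  by move=> r; apply: (ZsP (scale r)).2.
have /choice[C CP] : forall r, exists C : R, exists N, forall n, (N <= n)%N ->
    (capBS_at T u (part r) (s r) n (mesh (scale r)) < C%:E)%E.
  by move=> r; have [_ _ h] := sP r.
have /choice[N NP] := CP.
have /choice[G GP] : forall p : nat * nat, exists G : set X,
    (N p.1 <= p.2)%N -> part p.1 `<=` \bigcup_(y in G)
      bowen_ball T p.2 y (mesh (scale p.1)) /\
    (\esum_(y in G) pow2e (- (s p.1)%:E *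
       bowen_sup T u p.2 y (mesh (scale p.1))) <= (C p.1)%:E)%E.
  move=> [r n] /=; case: (boolP (N r <= n)%N) => [Nn|_]; last by exists set0.
  have /ereal_inf_lt[_ [G [cG pG] <-] GC] := NP r n Nn.
  by exists G => _; split=> //; exact: ltW.
pose q r : R := 2 `^ (- mesh (scale r)).
have q0 r : 0 < q r by exact: powR_gt0.
have q1 r : q r < 1 by apply: powR2_lt1; exact: mesh_gt0.
have C1 r : 0 < Num.max 1 (C r) by rewrite lt_max ltr01.
(* The sum over n is geometric with ratio q and leading factor
   2^(-c) max(1, C). *)
have /choice[c cP] : forall r, exists c : R, 0 <= c /\
    2 `^ (- c) <= 1 / (2 ^ r.+1)%:R * (1 - q r) / Num.max 1 (C r).
  move=> r; have [|c c0 cb] := @powR2_small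
      (1 / (2 ^ r.+1)%:R * (1 - q r) / Num.max 1 (C r)); last by exists c.
  by rewrite divr_gt0 // mulr_gt0 ?subr_gt0 // divr_gt0 // ltr0n expn_gt0.
pose F r : set (X * nat) := [set p | (N r <= p.2)%N /\ G (r, p.2) p.1].
have [||r|A AP] := @covers_oracle R X T u xs U Tcont ucont xs_dense Uuniv
    D F scale s c D0.
- by move=> r; have [s0 sD _] := sP r; apply/andP.
- by move=> r; exact: (cP r).1.
- have cost0 n y : (0 <= pow2e (- (s r)%:E *
      bowen_sup T u n y (mesh (scale r))))%E by exact: pow2e_ge0.
  have a0 : 0 <= 2 `^ (- c r) * Num.max 1 (C r) by rewrite mulr_ge0 ?powR_ge0 // ltW.
  apply: (@le_trans _ _
      (2 `^ (- c r) * Num.max 1 (C r) * q r ^+ N r / (1 - q r))%:E).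
    apply: (esum_slices (F := fun n => G (r, n))) => //.
      by move=> p; rewrite mule_ge0 // lee_fin powR_ge0.
    move=> n Nn /=; have [_ Gcost] := GP (r, n) Nn.
    have -> : 2 `^ (- (mesh (scale r) * n%:R + c r)) = 2 `^ (- c r) * q r ^+ n.
      rewrite opprD addrC powRD ?pnatr_eq0 ?implybT //.
      by rewrite -mulNr powRrM powR_mulrn ?powR_ge0.
    apply: esum_le_finite => l ul lG; rewrite -ge0_sume_distrr; last by [].
    have -> : 2 `^ (- c r) * Num.max 1 (C r) * q r ^+ n =
        2 `^ (- c r) * q r ^+ n * Num.max 1 (C r) by ring.
    rewrite [leRHS]EFinM; apply: lee_wpmul2l.
      by rewrite lee_fin mulr_ge0 ?powR_ge0 // exprn_ge0 // ltW.
    apply: le_trans (finite_le_esum _ ul lG) _ => //.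
    by apply: le_trans Gcost _; rewrite lee_fin le_max lexx orbT.
  rewrite lee_fin ler_pdivrMr ?subr_gt0 //.
  have := (cP r).2; rewrite ler_pdivlMr // => h; apply: le_trans h.
  rewrite -[leRHS]mulr1 ler_wpM2l // exprn_ile1 //; exact: ltW.
exists A; apply: nneg_sup_le => [|x Zx]; first by rewrite lee_fin.
apply/lee_addgt0Pr => tau tau0; rewrite -EFinD.
have [k0 k0P] := AP x tau (Zpos Zx) tau0.
apply: right_lim_le => [|e e0]; first exact: point_Dim_at_antitone.
have [k1 k1P] := mesh_small e0; pose k := maxn k0 k1.
exists (mesh k + mesh k); split.
- by rewrite addr_gt0 // mesh_gt0.
- by apply: k1P; rewrite leq_maxr.
- have [i _ xi] := (ZsP k).1 x Zx; pose r := Cantor.to_nat (k, i).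
  have rk : scale r = k by rewrite /scale Cantor.cancel_of_to.
  have xr : part r x by rewrite /part rk /r Cantor.cancel_of_to.
  have [n1 n1P] := k0P (c r).
  apply: (@limn_esup_le _ _ _ (maxn n1 (N r))) => n.
  rewrite geq_max => /andP[n1n Nn].
  have [/(_ x xr)[y Gy yx] _] := GP (r, n) Nn.
  rewrite -rk; apply: (n1P r n y) => //.
  by rewrite rk leq_maxl.
Qed.

End OptimalOracle.

Theorem theorem2 (R : realType) (X : metricType R)
    (Xcomplete : complete_space X)
    (xs : nat -> X) (xs_dense : dense (range xs))
    (T : X -> X) (Tcont : continuous T)
    (u : X -> R) (ucont : unif_continuous u)
    (U : oracle_code) (Uuniv : universal_prefix_free U)
    (Z : set X) (Zpos : forall x : X, Z x -> (0 < lower_average T u x)%E) :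
  is_minimum
    [set nneg_sup Z (fun x => point_dim xs U A T u x) | A in [set: set nat]]
    (dimBS T u Z) /\
  is_minimum
    [set nneg_sup Z (fun x => point_Dim xs U A T u x) | A in [set: set nat]]
    (DimBS T u Z).
Proof.
split; split.
- have [A AZ] := point_dim_le_dimBS Tcont ucont xs_dense Uuniv Zpos.
  exists A => //; apply/eqP; rewrite eq_le AZ /=.
  exact: dimBS_le_point_dim.
- by move=> _ [A _ <-]; exact: dimBS_le_point_dim.
- have [A AZ] := point_Dim_le_DimBS Tcont ucont xs_dense Uuniv Zpos.
  exists A => //; apply/eqP; rewrite eq_le AZ /=.
  exact: DimBS_le_point_Dim.
- by move=> _ [A _ <-]; exact: DimBS_le_point_Dim.
Qed.
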